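(* Let $(A,G,\alpha)$ be a pre-ordered Banach algebra dynamical system, with $A$ having a closed cone and a (not necessarily positive) bounded approximate right identity. Let $\alpha$ be uniformly bounded and let $\omega$ be a weight on $G$. Let $(\tilde\lambda,\Lambda)$ be the positive non-degenerate continuous covariant representation of $(A,G,\alpha)$ on $L^1(G,A,\omega)$ determined by $$[\tilde\lambda(a)h](s)=\alpha_s^{-1}(a)h(s),\qquad(\Lambda_rh)(s)=h(r^{-1}s)\qquad(h\in C_c(G,A),\ a\in A,\ r,s\in G).$$ Then the pre-ordered generalized Beurling algebra $L^1(G,A,\omega;\alpha)$ and the pre-ordered crossed product $(A\rtimes_\alpha G)^{\mathcal{R}}$ with $\mathcal{R}:=\{(\tilde\lambda,\Lambda)\}$ are bipositively topologically isomorphic via an isomorphism that is the identity on $C_c(G,A)$. Furthermore, the map $\tilde\lambda\rtimes\Lambda:C_c(G,A)\to B(L^1(G,A,\omega))$ extends to a positive topological embedding of $(A\rtimes_\alpha G)^{\mathcal{R}}$ into $B(L^1(G,A,\omega))$, and this extension is bipositive if $A$ has a positive bounded approximate right identity. If $A$ has a $1$-bounded right approximate identity, $\alpha$ lets $G$ act as isometries on $A$ and $\inf_{W\in\mathcal{Z}}\sup_{r\in W}\omega(r)=1$, with $\mathcal{Z}$ denoting a neighbourhood base of $e\in G$ of which all elements are contained in a fixed compact set, then the bipositive topological isomorphism between $(A\rtimes_\alpha G)^{\mathcal{R}}$ and $L^1(G,A,\omega;\alpha)$ that is the identity on $C_c(G,A)$ and the positive topological embedding of $(A\rtimes_\alpha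 G)^{\mathcal{R}}$ into $B(L^1(G,A,\omega))$ that extends $\tilde\lambda\rtimes\Lambda$ are both isometric.
   Context: All vector spaces are real; algebras are associative and not assumed unital; locally compact groups are Hausdorff; $e$ is the identity of $G$. A cone in a vector space $V$ is a subset $C$ with $C+C\subseteq C$ and $\lambda C\subseteq C$ for all $\lambda\ge0$. A pre-ordered vector space is a vector space $V$ with a chosen cone $V_+$. A linear map $T:V_1\to V_2$ is positive if $T(V_1)_+\subseteq(V_2)_+$, and bipositive if it is injective, positive, and $T^{-1}((V_2)_+)\subseteq(V_1)_+$. A pre-ordered algebra is an algebra and pre-ordered vector space with $V_+\cdot V_+\subseteq V_+$; a pre-ordered Banach algebra is a pre-ordered algebra that is also a Banach algebra. For a pre-ordered normed space $X$, $B(X)_+=\{T\in B(X):TX_+\subseteq X_+\}$. The completion of a pre-ordered normed space $V$ is its metric completion $\overline V$ with cone the closure of $V_+$ in $\overline V$. An approximate right identity is positive if its elements lie in the cone. $\mathrm{Aut}_+(A)$ is the group of bounded automorphisms $\beta$ of $A$ with $\beta^{\pm1}(A_+)\subseteq A_+$. A pre-ordered Banach algebra dynamical system $(A,G,\alpha)$ consists of a pre-ordered Banach algebra $A$ with closed cone, a locally compact group $G$ and a strongly continuous homomorphism $\alpha:G\to\mathrm{Aut}_+(A)$; $\alpha$ is uniformly bounded if $\sup_{s\in G}\|\alpha_s\|<\infty$. A covariant representation of $(A,G,\alpha)$ on a normed space $X$ is a pair $(\pi,U)$, $\pi:A\to B(X)$ an algebra homomorphism and $U$ a homomorphism of $G$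 into the invertible elements of $B(X)$, with $\pi(\alpha_s(a))=U_s\pi(a)U_s^{-1}$; it is continuous if $\pi$ is bounded and $U$ strongly continuous, non-degenerate if $\mathrm{span}\{\pi(a)x\}$ is dense in $X$, and positive (for pre-ordered $X$) if $\pi(A_+)\subseteq B(X)_+$ and $U_s^{\pm1}X_+\subseteq X_+$ for all $s$. $C_c(G,A)$ is an algebra under the twisted convolution $(f*g)(s)=\int_G f(r)\alpha_r(g(r^{-1}s))\,dr$ (left Haar measure). The integrated form of a continuous covariant representation on a Banach space $X$ is $\pi\rtimes U(f)x=\int_G\pi(f(r))U_rx\,dr$. A (non-empty) class $\mathcal{R}$ of continuous covariant representations on Banach spaces is uniformly bounded if there are $C\ge0$ and $\nu:G\to\mathbb{R}_{\ge0}$ bounded on compact sets with $\|\pi\|\le C$, $\|U_r\|\le\nu(r)$ for all $(\pi,U)\in\mathcal{R}$, $r\in G$ (this holds for $\mathcal{R}=\{(\tilde\lambda,\Lambda)\}$, with $\|\Lambda_r\|\le\omega(r)$). Put $\sigma^{\mathcal{R}}(f)=\sup_{(\pi,U)\in\mathcal{R}}\|\pi\rtimes U(f)\|$. The pre-ordered crossed product $(A\rtimes_\alpha G)^{\mathcal{R}}$ is the completion of $C_c(G,A)/\ker\sigma^{\mathcal{R}}$ with the norm induced by $\sigma^{\mathcal{R}}$ and the cone $q^{\mathcal{R}}(C_c(G,A_+))$, $q^{\mathcal{R}}$ being the quotient map; it is a pre-ordered Banach algebra whose cone is the closure of $q^{\mathcal{R}}(C_c(G,A_+))$. (For $\mathcal{R}=\{(\tilde\lambda,\Lambda)\}$,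 with $A$ having a bounded approximate right identity and $\alpha$ uniformly bounded, $\sigma^{\mathcal{R}}$ is a norm on $C_c(G,A)$, so that $C_c(G,A)$ is regarded as a subspace of the crossed product.) A weight on $G$ is a non-zero submultiplicative Borel measurable function $\omega:G\to[0,\infty)$. For a pre-ordered Banach space $X$ with closed cone, $L^1(G,X,\omega)$ is the completion (as pre-ordered normed space) of $(C_c(G,X),C_c(G,X_+))$ in the norm $\|h\|_{1,\omega}=\int_G\|h(s)\|\omega(s)\,ds$. If $\alpha$ is uniformly bounded, the twisted convolution on $C_c(G,A)$ extends to a continuous multiplication on $L^1(G,A,\omega)$; the resulting pre-ordered algebra, with the norm $\|\cdot\|_{1,\omega}$ (not necessarily submultiplicative), is the pre-ordered generalized Beurling algebra $L^1(G,A,\omega;\alpha)$. A topological isomorphism is an algebra isomorphism that is a homeomorphism; a topological embedding is a homeomorphism onto its image. *)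

(* Defs.v *)
From HB Require Import structures.
From mathcomp Require Import all_boot all_order all_algebra.
From mathcomp Require Import all_classical all_reals all_analysis.

Set Implicit Arguments.
Unset Strict Implicit.
Unset Printing Implicit Defensive.

Import Order.TTheory GRing.Theory Num.Theory.
Import numFieldNormedType.Exports.

Local Open Scope classical_set_scope.
Local Open Scope ring_scope.

HB.mixin Record isLCGroup G of PointedTopological G & Group G := {
  mulg_continuous : continuous (fun p : G * G => (p.1 * p.2)%g : G);
  invg_continuous : continuous (fun s : G => (s^-1)%g : G);
  lcg_hausdorff : hausdorff_space G;
  lcg_locally_compact : locally_compact [set: G]
}.

#[short(type="lcgroupType")]
HB.structure Definition LCGroup :=
  {G of PointedTopological G & Group G & isLCGroup G}.

Definition borel (G : lcgroupType) := g_sigma_algebraType (@open G).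

(* Rings in the library are unital, hence this separate multiplication. *)
HB.mixin Record Lmodule_isAlg (R : numFieldType) A of GRing.Lmodule R A := {
  amul : A -> A -> A;
  amulA : associative amul;
  amulDl : left_distributive amul +%R;
  amulDr : right_distributive amul +%R;
  amulZl : forall (k : R) (a b : A), amul (k *: a) b = k *: amul a b;
  amulZr : forall (k : R) (a b : A), amul a (k *: b) = k *: amul a b
}.

#[short(type="assocAlgType")]
HB.structure Definition AssocAlg (R : numFieldType) :=
  {A of GRing.Lmodule R A & Lmodule_isAlg R A}.

Notation "a ** b" := (amul a b) (at level 40, left associativity) : ring_scope.

Section AlgebraTheory.
Context {R : numFieldType}.
Variable A : assocAlgType R.
Implicit Types a b c : A.

Lemma amulNl a b : (- a) ** b = - (a ** b).
Proof. by rewrite -scaleN1r amulZl scaleN1r. Qed.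

Lemma amulNr a b : a ** (- b) = - (a ** b).
Proof. by rewrite -scaleN1r amulZr scaleN1r. Qed.

Lemma amulBB a b c d : a ** b - c ** d = (a - c) ** b + c ** (b - d).
Proof. by rewrite amulDl amulDr amulNl amulNr subrKA. Qed.

Lemma amula0 a : a ** 0 = 0.
Proof. by rewrite -[X in a ** X](scale0r 0) amulZr scale0r. Qed.

End AlgebraTheory.

HB.mixin Record Lmodule_hasCone (R : numFieldType) V of GRing.Lmodule R V := {
  vpos : set V;
  vposD : forall x y, vpos x -> vpos y -> vpos (x + y);
  vposZ : forall (k : R) x, 0 <= k -> vpos x -> vpos (k *: x)
}.
#[short(type="preVectType")]
HB.structure Definition PreVect (R : numFieldType) :=
  {V of GRing.Lmodule R V & Lmodule_hasCone R V}.
Arguments vpos {R s}.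

#[short(type="preNormedType")]
HB.structure Definition PreNormed (R : numFieldType) :=
  {V of NormedModule R V & Lmodule_hasCone R V}.

#[short(type="preBanachType")]
HB.structure Definition PreBanach (R : numFieldType) :=
  {V of CompleteNormedModule R V & Lmodule_hasCone R V}.

HB.mixin Record isPreAlg (R : numFieldType) A
    of AssocAlg R A & Lmodule_hasCone R A := {
  vposM : forall a b : A, vpos a -> vpos b -> vpos (a ** b)
}.

#[short(type="preAlgType")]
HB.structure Definition PreAlg (R : numFieldType) :=
  {A of AssocAlg R A & Lmodule_hasCone R A & isPreAlg R A}.

(* A pre-ordered algebra on a Banach space, the norm of which need not be
   submultiplicative. *)
#[short(type="preCompleteAlgType")]
HB.structure Definition PreCompleteAlg (R : numFieldType) :=
  {A of CompleteNormedModule R A & PreAlg R A}.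

HB.mixin Record isPreBanachAlg (R : numFieldType) A of PreCompleteAlg R A := {
  norm_amul : forall a b : A, `|a ** b| <= `|a| * `|b|
}.

#[short(type="preBanachAlgType")]
HB.structure Definition PreBanachAlg (R : numFieldType) :=
  {A of PreCompleteAlg R A & isPreBanachAlg R A}.

Section PositiveMaps.
Context {R : numFieldType}.

Definition positive_map (V W : preVectType R) (T : V -> W) :=
  T @` vpos `<=` vpos.

Definition bipositive_map (V W : preVectType R) (T : V -> W) :=
  [/\ injective T, positive_map T & T @^-1` vpos `<=` vpos].

End PositiveMaps.

Definition homeomorphism (S T : topologicalType) (f : S -> T) :=
  exists g : T -> S,
    [/\ cancel f g, cancel g f, continuous f & continuous g].

Definition topological_embedding (S T : topologicalType) (f : S -> T) :=
  [/\ injective f, continuous f &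
    forall U : set S, open U ->
      exists2 V : set T, open V & f @` U = V `&` range f].

Definition topological_isomorphism (R : numFieldType)
    (A B : preCompleteAlgType R) (f : {linear A -> B}) :=
  {morph f : a b / a ** b} /\ homeomorphism f.

Definition isometric (R : numFieldType) (V W : normedModType R) (f : V -> W) :=
  forall x, `|f x| = `|x|.

Section BoundedOperators.
Context {R : realType}.

Definition opnorm (X : normedModType R) (T : X -> X) : R :=
  sup [set `|T x| | x in [set x : X | `|x| <= 1]].

Definition bop_pred (X : normedModType R) : {pred X -> X} :=
  fun T => `[< linear T /\ continuous T >].

Record bop (X : normedModType R) := Bop {
  bop_fun :> X -> X;
  bop_funP : bop_fun \in @bop_pred X
}.

HB.instance Definition _ (X : normedModType R) := [isSub for @bop_fun X].
HB.instance Definition _ (X : normedModType R) := [Choice of bop X by <:].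

Lemma bop_subsemimod_closed (X : normedModType R) :
  subsemimod_closed (@bop_pred X).
Proof.
split; first split.
- apply/asboolP; split; last by move=> x; exact: cvg_cst.
  by move=> k u v; rewrite -[RHS]/(k *: 0 + 0 : X) scaler0 addr0.
- move=> S T /asboolP[Sl Sc] /asboolP[Tl Tc]; apply/asboolP; split.
    by move=> k u v; rewrite !addrfctE Sl Tl scalerDr addrACA.
  by move=> x; apply: cvgD; [exact: Sc|exact: Tc].
- move=> k T /asboolP[Tl Tc]; apply/asboolP; split.
    by move=> l u v; rewrite !scalrfctE Tl scalerDr !scalerA (mulrC l).
  by move=> x; apply: cvgZr; exact: Tc.
Qed.

HB.instance Definition _ (X : normedModType R) :=
  GRing.SubChoice_isSubLmodule.Build R (X -> X) (@bop_pred X) (bop X)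
    (@bop_subsemimod_closed X).

Section theory.
Variable X : normedModType R.
Implicit Types S T : bop X.

Lemma bop_linear T : linear T.
Proof. by case: T => T /= /asboolP[]. Qed.

Lemma bop_continuous T : continuous T.
Proof. by case: T => T /= /asboolP[]. Qed.

HB.instance Definition _ T :=
  GRing.isLinear.Build R X X *:%R T (bop_linear T).

Lemma bop_addE S T x : (S + T) x = S x + T x.
Proof. by rewrite (GRing.valD S T). Qed.

Lemma bop_scaleE k T x : (k *: T) x = k *: T x.
Proof. by rewrite (GRing.valZ k T). Qed.

Lemma bop_eq S T : S =1 T -> S = T.
Proof. by move=> ST; apply: val_inj; exact/funext. Qed.

Lemma bop_bound T : exists2 M : R, 0 <= M & forall x, `|T x| <= M * `|x|.
Proof.
have /linear_boundedP : bounded_near (T : {linear X -> X}) (nbhs (0 : X)).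
  exact/continuous_linear_bounded/bop_continuous.
move=> [M [Mr MT]]; exists (`|M| + 1); first by rewrite addr_ge0.
by apply: MT; rewrite (le_lt_trans (ler_norm M))// ltrDl.
Qed.

Lemma opnorm_has_sup T :
  has_sup [set `|T x| | x in [set x : X | `|x| <= 1]].
Proof.
split; first by exists `|T 0|, 0 => //=; rewrite normr0.
have [M M0 MT] := bop_bound T; exists M => _ [x /= x1 <-].
by rewrite (le_trans (MT x))// ler_piMr.
Qed.

Lemma opnorm_ub T x : `|x| <= 1 -> `|T x| <= opnorm T.
Proof. by move=> x1; apply: sup_upper_bound; [exact: opnorm_has_sup|exists x]. Qed.

Lemma opnorm_le T (M : R) :
  (forall x, `|x| <= 1 -> `|T x| <= M) -> opnorm T <= M.
Proof.
move=> TM; apply: ge_sup; first by case: (opnorm_has_sup T).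
by move=> _ [x x1 <-]; exact: TM.
Qed.

Lemma opnormP T x : `|T x| <= opnorm T * `|x|.
Proof.
have [->|x0] := eqVneq x 0; first by rewrite linear0 !normr0 mulr0.
have nx : 0 < `|x| by rewrite normr_gt0.
rewrite -ler_pdivrMr// mulrC.
suff -> : `|x|^-1 * `|T x| = `|T (`|x|^-1 *: x)|.
  by apply: opnorm_ub; rewrite normrZ normfV normr_id mulVf// gt_eqF.
by rewrite linearZ/= normrZ normfV normr_id.
Qed.

Lemma ler_opnormD S T : opnorm (S + T) <= opnorm S + opnorm T.
Proof.
apply: opnorm_le => x x1; rewrite bop_addE (le_trans (ler_normD _ _))//.
by apply: lerD; exact: opnorm_ub.
Qed.

Lemma opnorm_leZ (k : R) T : opnorm (k *: T) <= `|k| * opnorm T.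
Proof.
apply: opnorm_le => x x1; rewrite bop_scaleE normrZ ler_wpM2l//.
exact: opnorm_ub.
Qed.

Lemma opnormZ (k : R) T : opnorm (k *: T) = `|k| * opnorm T.
Proof.
apply/eqP; rewrite eq_le opnorm_leZ /=.
have [->|k0] := eqVneq k 0.
  rewrite normr0 mul0r; apply: le_trans (@opnorm_ub (0 *: T) 0 _) => //.
  by rewrite normr0.
rewrite mulrC -ler_pdivlMr ?normr_gt0// mulrC -normfV.
by rewrite -{1}[T](scalerK k0) opnorm_leZ.
Qed.

Lemma opnorm0_eq0 T : opnorm T = 0 -> T = 0.
Proof.
move=> T0; apply: bop_eq => x; apply/normr0_eq0/eqP.
by rewrite eq_le normr_ge0 andbT (le_trans (opnormP T x))// T0 mul0r.
Qed.

HB.instance Definition _ := Lmodule_isNormed.Build R (bop X)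
  ler_opnormD opnormZ opnorm0_eq0.

Lemma bop_comp_subproof S T : (S \o T) \in @bop_pred X.
Proof.
apply/asboolP; split; first by move=> k u v; rewrite /= !linearP.
by move=> x; apply: continuous_comp; exact: bop_continuous.
Qed.

Definition bop_comp S T := Bop (bop_comp_subproof S T).

Lemma bop_compA : associative bop_comp.
Proof. by move=> S T U; exact: bop_eq. Qed.

Lemma bop_compDl : left_distributive bop_comp +%R.
Proof. by move=> S T U; apply: bop_eq => x; rewrite [RHS]bop_addE; exact: bop_addE. Qed.

Lemma bop_compDr : right_distributive bop_comp +%R.
Proof.
move=> S T U; apply: bop_eq => x; rewrite [RHS]bop_addE.
by rewrite -[LHS]/(S ((T + U) x)) bop_addE linearD.
Qed.

Lemma bop_compZl (k : R) S T : bop_comp (k *: S) T = k *: bop_comp S T.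
Proof. by apply: bop_eq => x; rewrite [RHS]bop_scaleE; exact: bop_scaleE. Qed.

Lemma bop_compZr (k : R) S T : bop_comp S (k *: T) = k *: bop_comp S T.
Proof.
apply: bop_eq => x; rewrite [RHS]bop_scaleE.
by rewrite -[LHS]/(S ((k *: T) x)) bop_scaleE linearZ.
Qed.

HB.instance Definition _ := Lmodule_isAlg.Build R (bop X)
  bop_compA bop_compDl bop_compDr bop_compZl bop_compZr.

End theory.

Section cone.
Variable X : preNormedType R.

Definition bop_pos : set (bop X) := [set T | T @` vpos `<=` vpos].

Lemma bop_posD (S T : bop X) : bop_pos S -> bop_pos T -> bop_pos (S + T).
Proof.
move=> S0 T0 _ [x x0 <-]; rewrite bop_addE.
by apply: vposD; [apply: S0|apply: T0]; exists x.
Qed.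

Lemma bop_posZ (k : R) (T : bop X) : 0 <= k -> bop_pos T -> bop_pos (k *: T).
Proof.
move=> k0 T0 _ [x x0 <-]; rewrite bop_scaleE.
by apply: vposZ => //; apply: T0; exists x.
Qed.

HB.instance Definition _ := Lmodule_hasCone.Build R (bop X) bop_posD bop_posZ.

End cone.
End BoundedOperators.

Section ApproximateIdentity.
Context {R : realType}.

Definition directed (I : Type) (le : I -> I -> Prop) :=
  [/\ exists i : I, True, forall i, le i i,
    forall i j k, le i j -> le j k -> le i k &
    forall i j, exists k, le i k /\ le j k].

Definition has_bounded_approx_right_id (A : preBanachAlgType R) (M : R)
    (S : set A) :=
  exists (I : Type) (le : I -> I -> Prop) (u : I -> A),
    [/\ directed le, forall i, S (u i), forall i, `|u i| <= M &
      forall (a : A) (e : R), 0 < e ->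
        exists i0, forall i, le i0 i -> `|a ** u i - a| < e].

End ApproximateIdentity.

Section CompactlySupported.
Context {R : realType}.
Variables (G : lcgroupType) (V : normedModType R).

Definition Cc_pred : {pred G -> V} :=
  fun f => `[< continuous f /\ compact (closure [set s | f s != 0]) >].

Record Cc := MkCc { Cc_fun :> G -> V; Cc_funP : Cc_fun \in Cc_pred }.

HB.instance Definition _ := [isSub for Cc_fun].
HB.instance Definition _ := [Choice of Cc by <:].

Lemma compact_closure_sub (A B : set G) :
  A `<=` B -> compact (closure B) -> compact (closure A).
Proof.
by move=> AB cB; exact: subclosed_compact (@closed_closure _ _) cB (closureS AB).
Qed.

Lemma Cc_subsemimod_closed : subsemimod_closed Cc_pred.
Proof.
split; first split.
- apply/asboolP; split; first by move=> s; exact: cvg_cst.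
  rewrite (_ : [set _ | _] = set0) ?closure0; first exact: compact0.
  by apply/seteqP; split => s //=; rewrite eqxx.
- move=> f g /asboolP[fc fK] /asboolP[gc gK]; apply/asboolP; split.
    by move=> s; apply: cvgD; [exact: fc|exact: gc].
  apply: (@compact_closure_sub _ ([set s | f s != 0] `|` [set s | g s != 0])).
    move=> s /=; rewrite addrfctE; have [->|] := eqVneq (f s) 0; last by left.
    by rewrite add0r; right.
  by rewrite closureU; exact: compactU.
- move=> k f /asboolP[fc fK]; apply/asboolP; split.
    by move=> s; apply: cvgZr; exact: fc.
  apply: compact_closure_sub fK => s /=; apply: contra_neq => fs0.
  by rewrite scalrfctE fs0 scaler0.
Qed.

HB.instance Definition _ := GRing.SubChoice_isSubLmodule.Build R (G -> V)
  Cc_pred Cc Cc_subsemimod_closed.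

Lemma Cc_continuous (f : Cc) : continuous f.
Proof. by case: f => f /= /asboolP[]. Qed.

Lemma Cc_compact (f : Cc) : compact (closure [set s | f s != 0]).
Proof. by case: f => f /= /asboolP[]. Qed.

End CompactlySupported.
Arguments Cc_compact {R G V} f.

Definition Cc_pos {R : realType} (G : lcgroupType) (X : preNormedType R) :
  set (Cc G X) := [set f | forall s, vpos (f s)].
Arguments Cc_pos {R} G X _.

Section HaarMeasure.
Context {R : realType}.
Variable G : lcgroupType.

Record left_haar_measure (mu : {measure set (borel G) -> \bar R}) : Prop := {
  haar_neq0 : mu [set: G] <> 0%E;
  haar_compact : forall K : set G, compact K -> (mu K < +oo)%E;
  haar_outer : forall B : set (borel G), measurable B ->
    mu B = ereal_inf [set mu U | U in [set U : set G | open U /\ B `<=` U]];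
  haar_inner : forall U : set G, open U ->
    mu U = ereal_sup [set mu K | K in [set K : set G | compact K /\ K `<=` U]];
  haar_left : forall (s : G) (B : set (borel G)), measurable B ->
    mu [set (s * r)%g | r in B] = mu B
}.

Record weight (w : G -> R) : Prop := {
  weight_ge0 : forall s, 0 <= w s;
  weight_measurable : measurable_fun [set: borel G] (w : borel G -> R);
  weight_subM : forall r s, w (r * s)%g <= w r * w s;
  weight_neq0 : exists s, w s != 0
}.

Definition neighbourhood_base1 (Z : set (set G)) :=
  (forall W, Z W -> nbhs (1%g : G) W) /\
  (forall U, nbhs (1%g : G) U -> exists2 W, Z W & W `<=` U).

(* The integral defined by duality; for F continuous with compact support
   and X a Banach space it exists and is unique. *)
Definition is_vint (mu : {measure set (borel G) -> \bar R})
    (X : normedModType R) (F : G -> X) (v : X) :=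
  forall phi : {linear X -> R^o}, continuous phi ->
    mu.-integrable [set: borel G] (fun r => (phi (F r))%:E) /\
    (phi v)%:E = (\int[mu]_r (phi (F r))%:E)%E.

Definition vint (mu : {measure set (borel G) -> \bar R})
    (X : normedModType R) (F : G -> X) : X := get (is_vint mu F).

End HaarMeasure.

Section DynamicalSystems.
Context {R : realType}.

(* The inverse of a bounded automorphism is bounded by the open mapping
   theorem. *)
Record pos_automorphism (A : preBanachAlgType R) (b : A -> A) : Prop := {
  pos_aut_linear : linear b;
  pos_aut_mul : {morph b : x y / x ** y};
  pos_aut_bij : bijective b;
  pos_aut_continuous : continuous b;
  pos_aut_pos : b @` vpos `<=` vpos;
  pos_aut_inv_pos : b @^-1` vpos `<=` vpos
}.

Record dynsys (A : preBanachAlgType R) (G : lcgroupType) := {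
  act :> G -> A -> A;
  dynsys_closed : closed (vpos : set A);
  act_aut : forall s, pos_automorphism (act s);
  act_mul : forall r s a, act (r * s)%g a = act r (act s a);
  act_continuous : forall a, continuous (act^~ a)
}.

Variables (A : preBanachAlgType R) (G : lcgroupType) (alpha : dynsys A G).

Definition uniformly_bounded :=
  exists M : R, forall s a, `|alpha s a| <= M * `|a|.

Record covrep (X : normedModType R) := {
  crpi : {linear A -> bop X};
  crU : G -> bop X;
  crpi_mul : {morph crpi : a b / a ** b};
  crU1 : forall x, crU 1%g x = x;
  crU_mul : forall r s, crU (r * s)%g = crU r ** crU s;
  cr_covariant : forall s a,
    crpi (alpha s a) = crU s ** crpi a ** crU (s^-1)%g;
  crpi_bounded : exists M : R, forall a, `|crpi a| <= M * `|a|;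
  crU_continuous : forall x, continuous (fun s => crU s x)
}.

Definition nondegenerate (X : normedModType R) (rho : covrep X) :=
  dense [set x : X | exists (n : nat) (k : 'I_n -> R) (a : 'I_n -> A)
    (y : 'I_n -> X), x = \sum_(i < n) k i *: crpi rho (a i) (y i)].

Definition positive_rep (X : preNormedType R) (rho : covrep X) :=
  positive_map (crpi rho) /\ forall s, vpos (crU rho s).

Variable mu : {measure set (borel G) -> \bar R}.

Definition integrated (X : normedModType R) (rho : covrep X) (f : Cc G A) :
    X -> X :=
  fun x => vint mu (fun r => crpi rho (f r) (crU rho r x)).

(* The integral is again in C_c(G,A), so that the default value of insubd is
   never used. *)
Definition twisted_conv (f g : Cc G A) : Cc G A :=
  insubd (0 : Cc G A)
    (fun s => vint mu (fun r => f r ** alpha r (g (r^-1 * s)%g))).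

Definition banach_covrep := {X : completeNormedModType R & covrep X}.

(* Classes of representations are predicates: banach_covrep is too large for
   the universe of [set]. *)
Definition sigma (Rs : banach_covrep -> Prop) (f : Cc G A) : R :=
  sup [set x : R | exists2 rho, Rs rho & x = opnorm (integrated (projT2 rho) f)].

Definition singleton_class (X : completeNormedModType R) (rho : covrep X) :
    banach_covrep -> Prop :=
  fun rho' => rho' = existT (fun Y : completeNormedModType R => covrep Y) X rho.

(* The pair (C, q) is a crossed product when q is the canonical map of
   C_c(G,A) into the completion C of C_c(G,A) / ker (sigma Rs). *)
Record crossed_product (Rs : banach_covrep -> Prop) (C : preBanachAlgType R)
    (q : {linear Cc G A -> C}) : Prop := {
  cp_norm : forall f, `|q f| = sigma Rs f;
  cp_dense : dense (range q);
  cp_mul : forall f g, q (twisted_conv f g) = q f ** q g;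
  cp_pos : (vpos : set C) = closure (q @` Cc_pos G A)
}.

(* The pair (L, iota) is a completion of C_c(G,A) for the weighted L^1-norm,
   with the continuous extension of the twisted convolution. *)
Record beurling_algebra (w : G -> R) (L : preCompleteAlgType R)
    (iota : {linear Cc G A -> L}) : Prop := {
  ba_norm : forall f : Cc G A,
    (`|iota f|)%:E = (\int[mu]_s (`|f s| * w s)%:E)%E;
  ba_dense : dense (range iota);
  ba_mul_continuous : continuous (fun p : L * L => p.1 ** p.2);
  ba_mul : forall f g, iota (twisted_conv f g) = iota f ** iota g;
  ba_pos : (vpos : set L) = closure (iota @` Cc_pos G A)
}.

Lemma amul_cvg (T : Type) (F : set_system T) (f g : T -> A) (a b : A) :
  Filter F -> f @ F --> a -> g @ F --> b -> (fun t => f t ** g t) @ F --> a ** b.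
Proof.
move=> FF fa gb; apply/subr_cvg0; apply: norm_cvg0.
apply: (@squeeze_cvgr _ _ _ R (cst 0)
    (fun t => `|f t - a| * `|g t| + `|a| * `|g t - b|)).
- apply: nearW => t /=; rewrite normr_ge0/= amulBB (le_trans (ler_normD _ _))//.
  by apply: lerD; exact: norm_amul.
- exact: cvg_cst.
- rewrite -[0](_ : 0 * `|b| + `|a| * 0 = 0); last by rewrite mul0r mulr0 addr0.
  have f0 : `|f t - a| @[t --> F] --> (0 : R).
    by rewrite -(@normr0 _ A); apply: cvg_norm; exact/subr_cvg0.
  have g0 : `|g t - b| @[t --> F] --> (0 : R).
    by rewrite -(@normr0 _ A); apply: cvg_norm; exact/subr_cvg0.
  apply: cvgD; first by apply: cvgM => //; exact: cvg_norm.
  by apply: cvgM => //; exact: cvg_cst.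
Qed.

Lemma left_pi_subproof (a : A) (h : Cc G A) :
  (fun s => alpha (s^-1)%g a ** h s) \in @Cc_pred R G A.
Proof.
apply/asboolP; split.
  move=> s; apply: amul_cvg; last exact: Cc_continuous.
  apply: (@continuous_comp _ _ _ (fun s : G => (s^-1)%g) (alpha^~ a)).
    exact: invg_continuous.
  exact: act_continuous.
have := Cc_compact h; apply: compact_closure_sub => s /=.
apply: contra_neq => ->.
by rewrite amula0.
Qed.

Definition left_pi (a : A) (h : Cc G A) : Cc G A :=
  MkCc (left_pi_subproof a h).

Lemma left_mulg_continuous (r : G) : continuous (fun s : G => (r * s)%g).
Proof.
move=> s; apply: (@continuous_comp _ _ _ (fun s : G => (r, s))
  (fun p : G * G => (p.1 * p.2)%g)); last exact: mulg_continuous.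
by apply: cvg_pair => /=; [exact: cvg_cst|exact: cvg_id].
Qed.

Lemma left_shift_subproof (r : G) (h : Cc G A) :
  (fun s => h (r^-1 * s)%g) \in @Cc_pred R G A.
Proof.
apply/asboolP; split.
  move=> s; apply: (@continuous_comp _ _ _ (fun s : G => (r^-1 * s)%g) h).
    exact: left_mulg_continuous.
  exact: Cc_continuous.
set K := closure [set s | h s != 0].
have rK : compact [set (r * s)%g | s in K].
  apply: continuous_compact; last exact: Cc_compact.
  by apply: continuous_subspaceT; exact: left_mulg_continuous.
apply: (@compact_closure_sub G _ [set (r * s)%g | s in K]); last first.
  by rewrite -(closure_id _).1//; apply: compact_closed => //; exact: lcg_hausdorff.
move=> s /= hs; exists (r^-1 * s)%g; first exact: subset_closure.
by rewrite mulgA mulgV mul1g.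
Qed.

Definition left_shift (r : G) (h : Cc G A) : Cc G A :=
  MkCc (left_shift_subproof r h).

(* By density of the range of iota, the first two fields determine rho. *)
Record left_regular_rep (L : preCompleteAlgType R)
    (iota : {linear Cc G A -> L}) (rho : covrep L) : Prop := {
  lr_pi : forall a h, crpi rho a (iota h) = iota (left_pi a h);
  lr_U : forall r h, crU rho r (iota h) = iota (left_shift r h);
  lr_positive : positive_rep rho;
  lr_nondegenerate : nondegenerate rho
}.

End DynamicalSystems.

(* Main.v *)
Require Import Defs.
From HB Require Import structures.
From mathcomp Require Import all_boot all_order all_algebra.
From mathcomp Require Import all_classical all_reals all_analysis.
From mathcomp Require Import measurable_realfun ring lra.

Set Implicit Arguments.
Unset Strict Implicit.
Unset Printing Implicit Defensive.

Import Order.TTheory GRing.Theory Num.Theory.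
Import numFieldNormedType.Exports.

Local Open Scope classical_set_scope.
Local Open Scope ring_scope.

(** The idea is that twisting functions pointwise by the action, [h] to
    [s |-> alpha_s (h s)], turns the operator [lambda x Lambda (f)] on the
    weighted space [L] into left multiplication by [f] for the twisted
    convolution. The twist is a bipositive homeomorphism, so everything follows
    once the norm of [f] in [L] and the norm of left multiplication by [f] are
    shown to be equivalent.

    One inequality is the estimate
    [|pi (f r) (U_r x)| <= Ma * |f r| * (w r * |x|)] under the integral
    ([integrated_le]). For the other one an approximate right identity of [L] is
    needed. It is made of the functions [z (x) a], where [z] is a bump of
    integral one near the unit of the group and [a] runs through the approximate
    right identity of A: [integrated_approx] shows that the operator of [f] maps
    them arbitrarily close to the untwisted [f]. Their norms are bounded because
    a weight is locally bounded ([weight_le_shift]), and if the weight is at most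
    [1 + d] near the unit the bounds become sharp, whence the isometric case.

    The completions [L] and [C] of the same space for equivalent norms are then
    identified by extension from a dense subspace ([dense_extension]). The norm of
    [C] is by construction the operator norm of the integrated form, hence the
    integrated form extends to an isometry of [C] into the bounded operators
    ([integrated_extension]). If the approximate identity of A is positive, a
    positive operator in the image takes positive values on the functions
    [z (x) a], and those values approximate the element of [C] it comes from, up
    to the twist ([integrated_extension_reflects_pos]).

    The integrals are weak: the vector is determined by its values under
    continuous functionals. A case of the Hahn-Banach theorem
    ([norming_functional]) makes them unique and bounds their norms; the
    integral of a continuous function of compact support is a limit of
    Riemann sums ([is_vint_exists]). The same Riemann sums, computed in [L] and
    pointwise in A, prove [integrated_approx] without interchanging two
    integrals; taking [z] symmetric removes the modular function. *)

(** * Norming functionals *)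

Section HahnBanach.
Context {R : realType} {X : normedModType R}.
Implicit Types M N : set (X * R).

(** A linear functional on a subspace, dominated by the norm, as a relation: the
    domination makes the relation single-valued, and increasing unions of such
    relations are again such relations. *)
Definition dominated_graph M :=
  (forall k p q, M p -> M q -> M (k *: p.1 + q.1, k * p.2 + q.2)) /\
  (forall p, M p -> p.2 <= `|p.1|).

Lemma dominated_graph_line (x : X) :
  dominated_graph [set (t *: x, t * `|x|) | t in [set: R]].
Proof.
split=> [k _ _ [s _ <-] [t _ <-]|_ [t _ <-]]/=.
  by exists (k * s + t) => //=; rewrite scalerDl scalerA mulrDl mulrA.
by rewrite normrZ ler_wpM2r// ler_norm.
Qed.

Lemma dominated_graph_fun M y a b :
  dominated_graph M -> M (y, a) -> M (y, b) -> a = b.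
Proof.
move=> [Ml Md] Ma Mb.
suff le c d : M (y, c) -> M (y, d) -> d <= c.
  by apply/eqP; rewrite eq_le !le.
move=> Mc Mc'; have := Md _ (Ml (-1) _ _ Mc Mc').
by rewrite /= scaleN1r addNr normr0 mulN1r addrC subr_le0.
Qed.

(** The value [c] at the new vector must lie above all [p.2 - |p.1 - y|] and
    below all [|p.1 + y| - p.2]; the supremum of the former works. *)
Lemma dominated_graph_extend M y : dominated_graph M -> M (0, 0) ->
  exists c, dominated_graph
    [set (p.1 + t *: y, p.2 + t * c) | p in M & t in [set: R]].
Proof.
move=> [Ml Md] M0.
pose E := [set p.2 - `|p.1 - y| | p in M].
have MZ k p : M p -> M (k *: p.1, k * p.2).
  by move=> Mp; have := Ml k _ _ Mp M0; rewrite /= !addr0.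
have Eub p : M p -> ubound E (`|p.1 + y| - p.2).
  move=> Mp _ [r Mr <-]; rewrite lerBlDr addrAC lerBrDr.
  have := Md _ (Ml 1 _ _ Mr Mp); rewrite /= scale1r mul1r => /le_trans; apply.
  have -> : r.1 + p.1 = (r.1 - y) + (p.1 + y) by rewrite [p.1 + y]addrC addrA subrK.
  by rewrite addrC ler_normD.
have Esup : has_sup E.
  by split; [exists (0 - `|0 - y|), (0, 0)|exists (`|0 + y| - 0); exact: (Eub (0, 0))].
exists (sup E); split.
  move=> k _ _ [p Mp [s _ <-]] [q Mq [t _ <-]].
  exists (k *: p.1 + q.1, k * p.2 + q.2); first exact: Ml.
  exists (k * s + t) => //=; congr pair.
    by rewrite scalerDl scalerDr scalerA addrACA.
  by rewrite mulrDl mulrDr mulrA addrACA.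
move=> _ [p Mp [t _ <-]]/=.
have [t0|t0|->] := ltgtP t 0; last by rewrite scale0r mul0r !addr0 Md.
- have := sup_upper_bound Esup (ex_intro2 _ _ _ (MZ (- t)^-1 _ Mp) erefl).
  have nt0 : 0 < - t by rewrite oppr_gt0.
  rewrite /= -(ler_pM2l nt0) mulrBr mulrA divff ?gt_eqF// mul1r.
  rewrite -{1}(gtr0_norm nt0) -normrZ scalerBr scalerA divff ?gt_eqF// scale1r.
  by rewrite scaleNr opprK mulNr lerBlDr [leRHS]addrC lerBrDr.
- have : sup E <= `|t^-1 *: p.1 + y| - t^-1 * p.2.
    by apply: ge_sup; [case: Esup|exact: (Eub (_, _) (MZ t^-1 _ Mp))].
  move/(ler_wpM2l (ltW t0)).
  rewrite mulrBr mulrA divff ?gt_eqF// mul1r -[X in X * `|_|]gtr0_norm//.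
  by rewrite -normrZ scalerDr scalerA divff ?gt_eqF// scale1r lerBrDr addrC.
Qed.

(** The case of the Hahn-Banach theorem that makes the dual separate points:
    a maximal dominated graph containing the line through [x] is total. *)
Theorem norming_functional (x : X) :
  exists2 phi : {linear X -> R^o}, phi x = `|x| &
    forall y, `|phi y| <= `|y|.
Proof.
pose L := [set (t *: x, t * `|x|) | t in [set: R]].
have L0 : L (0, 0) by exists 0 => //; rewrite scale0r mul0r.
have [|A [PA Amax]] := @Zorn_bigcup _ [set M | dominated_graph (M `|` L)].
  move=> F FP Ftot; split; last first.
    move=> p [[Y FY Yp]|Lp]; first by apply: (FP _ FY).2; left.
    exact: (dominated_graph_line x).2.
  move=> k p q.
  have chain : (\bigcup_(Y in F) Y `|` L) p -> (\bigcup_(Y in F) Y `|` L) q ->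
      exists Y, [/\ dominated_graph (Y `|` L), (Y `|` L) p, (Y `|` L) q &
        Y `<=` \bigcup_(Y in F) Y].
    have Fsub Y : F Y -> Y `<=` \bigcup_(Y in F) Y by move=> FY z Yz; exists Y.
    move=> [[Y FY Yp]|Lp] [[Z FZ Zq]|Lq].
    - have [YZ|ZY] := Ftot _ _ FY FZ.
        by exists Z; split; [exact: FP|left; exact: YZ|left|exact: Fsub].
      by exists Y; split; [exact: FP|left|left; exact: ZY|exact: Fsub].
    - by exists Y; split; [exact: FP|left|right|exact: Fsub].
    - by exists Z; split; [exact: FP|right|left|exact: Fsub].
    - exists set0; rewrite set0U; split => //; exact: dominated_graph_line.
  move=> Mp Mq; have [Y [[Yl _] Yp Yq YF]] := chain Mp Mq.
  by have [/YF|] := Yl k _ _ Yp Yq; [left|right].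
set M := A `|` L in PA.
have M0 : M (0, 0) by right.
have Mtot y : exists a, M (y, a).
  apply: contrapT => /forallNP yM.
  have [c Mc] := dominated_graph_extend y PA M0.
  set N := [set _ | _ in _ & _ in _] in Mc.
  have MN : M `<=` N.
    by move=> p Mp; exists p => //; exists 0 => //; rewrite scale0r mul0r !addr0; case: p Mp.
  have Nyc : N (y, c).
    by exists (0, 0) => //; exists 1 => //=; rewrite scale1r mul1r !add0r.
  apply: (Amax N); last first.
    by rewrite /= (setUidl _)// => p Lp; apply: MN; right.
  split; first by move=> p Ap; apply: MN; left.
  by move=> /(_ _ Nyc) Ayc; apply: (yM c); left.
have [phi phiM] := choice Mtot.
have phi_lin : linear (phi : X -> R^o).
  move=> k u v; apply: (dominated_graph_fun PA (phiM _)).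
  exact: PA.1 k (u, phi u) (v, phi v) (phiM u) (phiM v).
pose phiL : {linear X -> R^o} := HB.pack phi (GRing.isLinear.Build R X R^o *:%R phi phi_lin).
exists phiL.
  apply: (dominated_graph_fun PA (phiM x)); right; exists 1 => //.
  by rewrite scale1r mul1r.
move=> y; rewrite ler_norml (PA.2 _ (phiM y)) andbT lerNl.
rewrite -[- _](linearN phiL) -[`|y|]normrN; exact: PA.2 (phiM _).
Qed.

End HahnBanach.

Lemma linear_bound_continuous {R : realType} (X Y : normedModType R)
    (T : {linear X -> Y}) (M : R) :
  (forall x, `|T x| <= M * `|x|) -> continuous T.
Proof.
move=> TM; apply: bounded_linear_continuous.
apply/linear_boundedP; near=> r => x.
by rewrite (le_trans (TM x))// ler_wpM2r.
Unshelve. all: by end_near. Qed.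

Lemma continuous_linear_bound {R : realType} (X Y : normedModType R)
    (T : {linear X -> Y}) : continuous T ->
  exists2 M : R, 0 < M & forall x, `|T x| <= M * `|x|.
Proof.
by move=> cT; apply/pinfty_ex_gt0/linear_boundedP/continuous_linear_bounded/cT.
Qed.

(** * Functions on a locally compact group *)

Section Topology.
Context {R : realType} {G : lcgroupType}.
Implicit Types (K U V W : set G) (r s t : G).

Lemma nbhs_left_mulg r s V : nbhs (r * s)%g V -> nbhs s [set t | V (r * t)%g].
Proof. exact: left_mulg_continuous. Qed.

Lemma nbhs1_invg V : nbhs (1%g : G) V -> nbhs (1%g : G) [set s | V (s^-1)%g].
Proof. by move=> V1; apply: (@invg_continuous G 1%g); rewrite invg1. Qed.

Lemma lcg_compact_closed K : compact K -> closed K.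
Proof. by apply: compact_closed; exact: lcg_hausdorff. Qed.

Lemma compact_closureT K W : compact K -> W `<=` K -> compact (closure W).
Proof.
move=> cK WK; apply: (compact_closure_sub WK).
by rewrite -(closure_id _).1//; exact: lcg_compact_closed.
Qed.

Lemma compact_nbhs s : exists2 K, nbhs s K & compact K.
Proof.
have [K sK [cK _]] := @lcg_locally_compact G s Logic.I.
by exists K => //; rewrite /within/= in sK; apply: filterS sK => t /(_ Logic.I).
Qed.

Lemma point_bump s V : nbhs s V ->
  exists h : G -> R, [/\ continuous h, (forall t, 0 <= h t), h s = 1,
    (forall t, ~ V t -> h t = 0) & compact (closure [set t | h t != 0])].
Proof.
move=> sV; have [K sK cK] := compact_nbhs s.
pose W := (V `&` K)°.
have sW : nbhs s W by apply: nbhs_interior; exact: filterI.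
have clW : closed (~` W) by apply: open_closedC; exact: open_interior.
have nWs : ~ (~` W) s by apply; exact: nbhs_singleton.
have sep := @locally_compact_completely_regular G R (@lcg_locally_compact G)
  (@lcg_hausdorff G) s _ clW nWs.
pose u : G -> R := Urysohn [set s] (~` W).
have u01 t : 0 <= u t <= 1.
  have : `[0, 1]%classic (u t) by apply: (@Urysohn_range _ R [set s] (~` W)); exists t.
  by rewrite /= in_itv.
have u1 t : ~ W t -> u t = 1.
  by move=> nWt; apply: (@Urysohn_sub1 _ R _ _ sep); exists t.
have W0 t : 1 - u t != 0 -> W t.
  by move=> /eqP h0; apply: contrapT => /u1 ut; rewrite ut subrr in h0.
exists (fun t => 1 - u t); split.
- by move=> t; apply: cvgB; [exact: cvg_cst|exact: Urysohn_continuous].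
- by move=> t; rewrite subr_ge0; case/andP: (u01 t).
- have -> : u s = 0 by apply: (@Urysohn_sub0 _ R _ _ sep); exists s.
  by rewrite subr0.
- move=> t nVt; rewrite u1 ?subrr// => Wt; apply: nVt.
  by case: (interior_subset Wt).
- by apply: (compact_closureT cK) => t /W0/interior_subset[].
Qed.

(** Symmetry makes the integral of a bump invariant under [s |-> s^-1], so that
    the modular function of the group never enters. *)
Lemma symmetric_bump V : nbhs (1%g : G) V ->
  exists h : Cc G R^o, [/\ forall t, 0 <= h t, 0 < h 1%g,
    forall t, h (t^-1)%g = h t & forall t, ~ V t -> h t = 0].
Proof.
move=> V1; have [K K1 cK] := compact_nbhs 1%g.
pose N := (V `&` K) `&` [set s | (V `&` K) (s^-1)%g].
have N1 : nbhs (1%g : G) N.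
  by apply: filterI; [|apply: nbhs1_invg]; exact: filterI.
have [h [hc h0 h1 hN _]] := point_bump N1.
pose z t := h t + h (t^-1)%g.
have zN t : z t != 0 -> N t.
  move=> zt; apply: contrapT => nN; case/eqP: zt; rewrite /z !hN ?addr0//.
  by move=> [NV]; rewrite /= invgK => ?; exact: nN.
have zcc : (z : G -> R^o) \in @Cc_pred R G R^o.
  apply/asboolP; split.
    move=> t; apply: cvgD; first exact: hc.
    apply: (@continuous_comp _ _ _ (fun s : G => (s^-1)%g) h); last exact: hc.
    exact: invg_continuous.
  by apply: (compact_closureT cK) => t /= /zN [[]].
exists (MkCc zcc); split => /=.
- by move=> t; rewrite addr_ge0.
- by rewrite /z invg1 h1 addr_gt0.
- by move=> t; rewrite /z invgK addrC.
- move=> t nV; apply/eqP; apply: contrapT => /negP /zN [[Vt _] _]; exact: nV.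
Qed.

(** The tube argument: the neighbourhoods of [t0] that work near the points of
    [K] have a common one by compactness. *)
Lemma compact_uniform (X : normedModType R) (T : topologicalType) K
    (F : G -> T -> X) (t0 : T) (e : R) : compact K -> 0 < e ->
  (forall s, K s -> {for (s, t0), continuous (fun p => F p.1 p.2)}) ->
  \forall t \near t0, forall s, K s -> `|F s t - F s t0| < e.
Proof.
move=> cK e0 Fc.
apply: (@compact_near_coveringP _ K).1 => // s Ks.
have e20 : 0 < e / 2 by rewrite divr_gt0.
have Fst := Fc s Ks; move/cvgrPdist_lt : (Fst) => /(_ _ e20) [[P Q]/= [sP tQ] PQ].
exists (P, Q) => //= -[s' t] [/= Ps Qt].
have d1 := PQ (s', t) (conj Ps Qt).
have d2 := PQ (s', t0) (conj Ps (nbhs_singleton tQ)).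
rewrite /= in d1 d2.
have -> : F s' t - F s' t0 = (F s t0 - F s' t0) - (F s t0 - F s' t).
  by rewrite opprB [RHS]addrC subrKA.
by rewrite (le_lt_trans (ler_normB _ _))// (splitr e) ltrD.
Qed.

Lemma Cc_support (X : normedModType R) (f : Cc G X) :
  exists2 K, compact K & forall s, ~ K s -> f s = 0.
Proof.
exists (closure [set s | f s != 0]); first exact: Cc_compact.
move=> s nKs; apply/eqP; apply: contrapT => /negP fs; apply: nKs.
exact: subset_closure.
Qed.

(** On the support this is [compact_uniform]. If only [s * v] lies in the support,
    the estimate at [s * v] for the increment [v^-1] applies. *)
Lemma Cc_uniformly_continuous (X : normedModType R) (f : Cc G X) (e : R) :
  0 < e -> \forall v \near (1%g : G), forall s, `|f (s * v)%g - f s| < e.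
Proof.
move=> e0; have [K cK fK] := Cc_support f.
have near1 : \forall v \near (1%g : G), forall s, K s -> `|f (s * v)%g - f s| < e.
  have := @compact_uniform X _ K (fun s v => f (s * v)%g) 1%g e cK e0.
  move=> /(_ _)/wrap[s Ks|].
    apply: (@continuous_comp _ _ _ (fun p : G * G => (p.1 * p.2)%g) f).
      exact: mulg_continuous.
    exact: Cc_continuous.
  by apply: filterS => v /= fv s Ks; have := fv s Ks; rewrite mulg1.
have near2 := nbhs1_invg near1.
near=> v => s.
have [Ks|nKs] := pselect (K s); first by move: s Ks; near: v.
have [Ksv|nKsv] := pselect (K (s * v)%g).
  rewrite distrC -{1}(mulgK v s); move: (s * v)%g Ksv; near: v.
  exact: near2.
by rewrite !fK// subrr normr0.
Unshelve. all: by end_near. Qed.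
End Topology.

(** * Haar measure *)

Section BorelMeasurability.
Context {R : realType} {G : lcgroupType}.
Implicit Types (K U V : set G).

Lemma borel_open U : open U -> measurable (U : set (borel G)).
Proof. by move=> oU; exact: sub_sigma_algebra. Qed.

Lemma borel_closed U : closed U -> measurable (U : set (borel G)).
Proof. by move=> /closed_openC/borel_open/measurableC; rewrite setCK. Qed.

Lemma borel_compact K : compact K -> measurable (K : set (borel G)).
Proof. by move=> /lcg_compact_closed/borel_closed. Qed.

Lemma continuous_borel_fun (f : G -> R) :
  continuous f -> measurable_fun [set: borel G] (f : borel G -> R).
Proof.
move=> /continuousP cf.
apply: (measurability _ (measurable_realfun.RGenOpens.measurableE R)).
move=> _ [_ [a [b ->] <-]]; rewrite setTI; apply: borel_open.
exact/cf/interval_open.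
Qed.

Lemma continuous_borel_map (f : G -> G) :
  continuous f -> measurable_fun [set: borel G] (f : borel G -> borel G).
Proof.
move=> /continuousP cf; apply: (@measurability _ _ (borel G) (borel G) _ f (@open G)).
  by [].
by move=> _ [U oU <-]; rewrite setTI; apply: borel_open; exact: cf.
Qed.

Lemma bigsetU_ordP (T : Type) n (B : 'I_n -> set T) t :
  (\big[setU/set0]_(i < n) B i) t <-> exists i, B i t.
Proof.
rewrite -bigcup_seq; split=> [[i _ Bi]|[i Bi]]; first by exists i.
by exists i => //=; rewrite mem_index_enum.
Qed.

(** The pieces of a Riemann sum: the neighbourhoods [N s] encode how little the
    integrands may vary on a piece. *)
Lemma compact_partition K (N : G -> set G) :
  compact K -> (forall s, K s -> nbhs s (N s)) ->
  exists n (c : 'I_n -> G) (B : 'I_n -> set (borel G)),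
    [/\ forall i, measurable (B i), trivIset setT B,
       \big[setU/set0]_(i < n) B i = K,
       forall i, K (c i) & forall i r, B i r -> N (c i) r].
Proof.
move=> cK KN.
have : @cover_compact G K by rewrite -compact_cover.
move=> /(_ G K (fun s => (N s)°))[|s Ks|D DK KD].
- by move=> s _; exact: open_interior.
- by exists s => //; exact: KN.
pose l : seq G := finmap.enum_fset D.
pose c (i : 'I_(size l)) := tnth (in_tuple l) i.
pose F (k : nat) : set (borel G) := K `&` (N (nth point l k))°.
have mF k : measurable (F k).
  apply: measurableI; first exact: borel_compact.
  by apply: borel_open; exact: open_interior.
exists (size l), c, (fun i => seqDU F i); split.
- by move=> i; exact: seqDU_measurable.
- move=> i j _ _ ij; apply: val_inj.
  exact: (@trivIset_seqDU _ F i j).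
- rewrite -bigsetU_seqDU; apply/seteqP; split.
    by move=> s; rewrite -bigcup_mkord => -[k _ []].
  move=> s Ks; have [t tD Nts] := KD _ Ks.
  rewrite -bigcup_mkord; exists (index t l); first by rewrite /= index_mem.
  by split=> //; rewrite nth_index.
- by move=> i; apply/set_mem/DK; exact: mem_tnth.
- move=> i r Br; have [_ /interior_subset] := @subset_seqDU _ F i r Br.
  by rewrite /c (tnth_nth point).
Qed.

End BorelMeasurability.

Section Haar.
Context {R : realType} {G : lcgroupType}.
Variable mu : {measure set (borel G) -> \bar R}.
Hypothesis haar_mu : left_haar_measure mu.
Implicit Types (K U V : set G).

Lemma haar_integral_left_mulg (r : G) (f : borel G -> \bar R) :
  measurable_fun [set: borel G] f -> (forall s, 0 <= f s)%E ->
  (\int[mu]_s f (r * s)%g = \int[mu]_s f s)%E.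
Proof.
move=> mf f0.
have mr : measurable_fun [set: borel G] ((fun s => r * s)%g : borel G -> borel G).
  by apply: continuous_borel_map; exact: left_mulg_continuous.
have := @ge0_integral_pushforward _ _ _ _ R _ mr mu setT f measurableT mf.
rewrite preimage_setT => <-; last by move=> s _; exact: f0.
apply: eq_measure_integral => B mB _; rewrite /pushforward.
rewrite -(haar_left haar_mu r^-1%g mB); congr (mu _).
apply/seteqP; split => [s Brs|_ [s Bs <-]]; last by rewrite /= mulVKg.
by exists (r * s)%g => //; rewrite mulKg.
Qed.

(** If [V] were null, then so would be every compact set, being covered by
    finitely many translates of [V], and inner regularity would make the whole
    group null. *)
Lemma haar_open_gt0 V : open V -> V !=set0 -> (0 < mu V)%E.
Proof.
move=> oV [v Vv]; rewrite lt0e measure_ge0 andbT; apply/eqP => V0.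
apply: (haar_neq0 haar_mu); rewrite (haar_inner haar_mu openT).
apply/eqP; rewrite eq_le; apply/andP; split; last first.
  apply: ereal_sup_ubound; exists set0; last by rewrite measure0.
  by split; [exact: compact0|].
apply: ge_ereal_sup => _ [K [cK _] <-].
pose N (s : G) := [set (s * v^-1 * r)%g | r in V].
have NV s : N s = (fun r => (s * v^-1)^-1 * r)%g @^-1` V.
  apply/seteqP; split => [_ [r Vr <-]|r Vr]; first by rewrite /= mulKg.
  by exists ((s * v^-1)^-1 * r)%g => //; rewrite mulVKg.
have oN s : open (N s).
  rewrite NV; apply: open_comp oV => r _; exact: left_mulg_continuous.
have [|n [c [B [mB tB BK cK' BN]]]] := @compact_partition G K N cK.
  move=> s Ks; apply: open_nbhs_nbhs; split; first exact: oN.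
  by exists v => //; rewrite mulgVK.
rewrite -BK measure_bigsetU_ord// big1// => i _; apply/eqP; rewrite eq_le measure_ge0 andbT.
rewrite -V0 -[leRHS](haar_left haar_mu (c i * v^-1)%g (borel_open oV)).
by apply: le_measure; rewrite ?inE//; [apply: borel_open; exact: oN|exact: BN].
Qed.

Lemma integrable_compact_support K (g : G -> R) (M : R) : compact K ->
  measurable_fun [set: borel G] (g : borel G -> R) ->
  (forall s, ~ K s -> g s = 0) -> (forall s, `|g s| <= M) ->
  mu.-integrable [set: borel G] (fun s => (g s)%:E).
Proof.
move=> cK mg gK gM.
have -> : (fun s => (g s)%:E) = (EFin \o g) \_ K :> (borel G -> \bar R).
  by apply/funext => s; rewrite patchE; case: ifPn => // /negP; rewrite inE => /gK ->.
rewrite -integrable_mkcond; last exact: borel_compact.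
apply: measurable_bounded_integrable.
- exact: borel_compact.
- exact: haar_compact.
- exact: measurable_funTS.
- exists M; split; first exact: num_real.
  by move=> r Mr s _ /=; rewrite (le_trans (gM s))// ltW.
Qed.

Lemma partition_mass K n (B : 'I_n -> set (borel G)) :
  compact K -> (forall i, measurable (B i)) -> trivIset setT B ->
  \big[setU/set0]_(i < n) B i = K ->
  [/\ forall i, mu (B i) \is a fin_num &
    \sum_(i < n) fine (mu (B i)) = fine (mu K)].
Proof.
move=> cK mB tB BK.
have BKi i : B i `<=` K by rewrite -BK => s Bs; apply/bigsetU_ordP; exists i.
have fB i : mu (B i) \is a fin_num.
  rewrite ge0_fin_numE// (le_lt_trans _ (haar_compact haar_mu cK))//.
  by apply: le_measure; rewrite ?inE//; exact: borel_compact.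
by split => //; rewrite -BK measure_bigsetU_ord// sum_fine.
Qed.

Lemma riemann_sum_scalar K n (c : 'I_n -> G) (B : 'I_n -> set (borel G))
    (g : G -> R) (v d : R) :
  compact K -> (forall i, measurable (B i)) -> trivIset setT B ->
  \big[setU/set0]_(i < n) B i = K ->
  measurable_fun [set: borel G] (g : borel G -> R) ->
  (forall s, ~ K s -> g s = 0) ->
  (forall i r, B i r -> `|g r - g (c i)| <= d) ->
  v%:E = (\int[mu]_s (g s)%:E)%E ->
  `|v - \sum_(i < n) fine (mu (B i)) * g (c i)| <= d * fine (mu K).
Proof.
move=> cK mB tB BK mg gK gd gv.
have [fB sB] := partition_mass cK mB tB BK.
have mgB i : measurable_fun (B i) (g : borel G -> R) by exact: measurable_funTS.
have step i : exists x, x%:E = (\int[mu]_(s in B i) (g s)%:E)%E /\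
    `|x - fine (mu (B i)) * g (c i)| <= d * fine (mu (B i)).
  have Boo : (mu (B i) < +oo)%E by rewrite -ge0_fin_numE.
  have ig : mu.-integrable (B i) (EFin \o (g : borel G -> R)).
    apply: measurable_bounded_integrable => //.
    exists (d + `|g (c i)|); split; first exact: num_real.
    move=> M dM r Br; rewrite /= ltW// (le_lt_trans _ dM)//.
    by rewrite -[g r](subrK (g (c i))) (le_trans (ler_normD _ _))// lerD2r gd.
  have ic : mu.-integrable (B i) (EFin \o cst (g (c i)) : borel G -> \bar R).
    apply: measurable_bounded_integrable => //.
    by exists `|g (c i)|; split; [exact: num_real|move=> M dM r _; exact: ltW].
  exists (fine (\int[mu]_(s in B i) (g s)%:E)%E).
  have gfin := integrable_fin_num (mB i) ig.
  split; first by rewrite fineK.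
  rewrite -lee_fin EFinM fineK// -(integral_cst mu (mB i) d%:E).
  have -> : `|fine (\int[mu]_(s in B i) (g s)%:E)%E - fine (mu (B i)) * g (c i)|%:E =
      `|\int[mu]_(s in B i) ((g s)%:E - (g (c i))%:E)|%E.
    rewrite integralB// (integral_cst mu (mB i) (g (c i))%:E).
    by rewrite -(fineK gfin) -(fineK (fB i)) /= mulrC.
  rewrite (le_trans (le_abse_integral _ _ _))//.
    by apply: emeasurable_funB; apply/measurable_EFinP.
  apply: ge0_le_integral => //.
  - apply: measurableT_comp => //.
    by apply: emeasurable_funB; apply/measurable_EFinP.
  - by move=> r Br; rewrite lee_fin gd.
have [x xP] := choice step.
have vE : v = \sum_(i < n) x i.
  apply: EFin_inj; rewrite gv -sumEFin.
  have -> : (\int[mu]_s (g s)%:E = \int[mu]_(s in K) (g s)%:E)%E.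
    rewrite [RHS]integral_mkcond; apply: eq_integral => s _.
    by rewrite patchE; case: ifPn => // /negP; rewrite inE => /gK ->.
  rewrite -BK integral_bigsetU_EFin//.
  - by apply: eq_bigr => i _; rewrite (xP i).1.
  - exact: index_enum_uniq.
  - by apply: sub_trivIset tB.
  - by apply/measurable_EFinP; exact: measurable_funTS.
rewrite vE -sumrB (le_trans (ler_norm_sum _ _ _))//.
by rewrite -sB mulr_sumr ler_sum// => i _; exact: (xP i).2.
Qed.

End Haar.

(** * Approximation in normed spaces *)

Section NormedApproximation.
Context {R : realType}.
Implicit Types (X : normedModType R).

Lemma closure_approx X (S : set X) (x : X) :
  closure S x <-> forall e : R, 0 < e -> exists2 y, S y & `|x - y| < e.
Proof.
split=> [Sx e e0|Sx U /nbhs_ballP[e/= e0 xeU]].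
  have [|y [Sy]] := Sx (ball x e); first exact: nbhsx_ballx.
  by rewrite -ball_normE; exists y.
have [y Sy xy] := Sx e e0; exists y; split => //; apply: xeU.
by rewrite -ball_normE.
Qed.

Lemma dense_approx X (S : set X) : dense S ->
  forall (x : X) (e : R), 0 < e -> exists2 y, S y & `|x - y| < e.
Proof.
move=> dS x e e0.
have [||y [xy Sy]] := dS (ball x e).
- by exists x; exact: ballxx.
- exact: ball_open.
- by exists y => //; move: xy; rewrite -ball_normE.
Qed.

Lemma harmonic_lt (C e : R) : 0 < e -> exists n : nat, C / n.+1%:R < e.
Proof.
move=> e0; have : C * @harmonic R n @[n --> \oo] --> C * 0.
  by apply: cvgM; [exact: cvg_cst|exact: cvg_harmonic].
rewrite mulr0 => /cvgrPdist_lt /(_ e e0) [n _ /(_ n (leqnn n))] /=.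
by rewrite sub0r normrN => /(le_lt_trans (ler_norm _)) ?; exists n.
Qed.

Lemma le_harmonic (C x : R) : (forall n, x <= C / n.+1%:R) -> x <= 0.
Proof.
move=> xC; apply/ler_addgt0Pr => e e0; rewrite add0r.
by have [n /ltW] := harmonic_lt C e0; exact: le_trans.
Qed.

(** Completeness with an explicit rate, which lets the limit inherit the
    estimates known for the approximants. *)
Lemma harmonic_cauchy (X : completeNormedModType R) (u : nat -> X) (C : R) :
  (forall m n, `|u m - u n| <= C / m.+1%:R + C / n.+1%:R) ->
  exists l, forall n, `|l - u n| <= C / n.+1%:R.
Proof.
move=> uC.
have C0 n : 0 <= C / n.+1%:R.
  by have := le_trans (normr_ge0 _) (uC n n); rewrite -mulr2n pmulrn_lge0.
have hdec (m n : nat) : (m <= n)%N -> C / n.+1%:R <= C / m.+1%:R.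
  move=> mn; have C0' : 0 <= C by have := C0 0; rewrite divr1.
  by rewrite ler_wpM2l// lef_pV2 ?posrE// ler_nat.
have /cauchy_cvgP cu : cauchy (u @ \oo).
  apply/cauchy_ballP => e e0.
  have [n ne] := harmonic_lt C (divr_gt0 e0 (ltr0n _ 2)).
  exists ([set u m | m in [set m | (n <= m)%N]], [set u m | m in [set m | (n <= m)%N]]).
    by split; exists n => //= m nm; exists m.
  move=> [_ _] [/= [i ni <-] [j nj <-]]; rewrite -ball_normE /=.
  rewrite (le_lt_trans (uC i j))// [ltRHS]splitr ltrD//.
    exact: le_lt_trans (hdec _ _ ni) ne.
  exact: le_lt_trans (hdec _ _ nj) ne.
exists (lim (u @ \oo)) => n; apply/ler_addgt0Pr => e e0.
have [N Ne] := harmonic_lt C (divr_gt0 e0 (ltr0n _ 2)).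
move/cvgrPdist_lt : cu => /(_ _ (divr_gt0 e0 (ltr0n _ 2)))[M _ Mu].
pose k := maxn M N.
rewrite -[_ - u n](subrKA (u k)) (le_trans (ler_normD _ _))//.
have := uC k n; have := Mu k (leq_maxl _ _).
have := le_lt_trans (hdec _ _ (leq_maxr M N)) Ne.
rewrite /= -/k; move: (C / k.+1%:R) (C / n.+1%:R) `|_ - u k| `|_ - u n| => *; lra.
Qed.

End NormedApproximation.

(** * The weak integral *)

Section WeakIntegral.
Context {R : realType} {G : lcgroupType}.
Variable mu : {measure set (borel G) -> \bar R}.
Hypothesis haar_mu : left_haar_measure mu.
Implicit Types X : normedModType R.

Lemma is_vint_norm_le X (F : G -> X) (v : X) (k : G -> R) (M : R) :
  is_vint mu F v -> measurable_fun [set: borel G] (k : borel G -> R) ->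
  (forall r, `|F r| <= k r) -> (\int[mu]_r (k r)%:E <= M%:E)%E -> `|v| <= M.
Proof.
move=> Fv mk Fk kM; have [phi phiv phi1] := norming_functional v.
have phi1' y : `|phi y| <= 1 * `|y| by rewrite mul1r.
have [/integrableP[mphiF _] phivE] := Fv phi (linear_bound_continuous phi1').
rewrite -lee_fin; apply: le_trans kM.
have -> : (`|v|%:E = `|(phi v)%:E|)%E by rewrite phiv /= normr_id.
rewrite phivE (le_trans (le_abse_integral _ _ _))//.
apply: ge0_le_integral => //; first exact: measurableT_comp.
- exact/measurable_EFinP.
- by move=> r _ /=; rewrite lee_fin (le_trans (phi1 _)).
Qed.

Lemma is_vint_unique X (F : G -> X) (u v : X) :
  is_vint mu F u -> is_vint mu F v -> u = v.
Proof.
move=> Fu Fv; apply/eqP; rewrite -subr_eq0 -normr_eq0.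
have [phi <- phi1] := norming_functional (u - v).
have phi1' y : `|phi y| <= 1 * `|y| by rewrite mul1r.
have phic := linear_bound_continuous phi1'.
rewrite linearB subr_eq0; apply/eqP/EFin_inj.
by rewrite (Fu phi phic).2 (Fv phi phic).2.
Qed.

Lemma vintE X (F : G -> X) (v : X) : is_vint mu F v -> vint mu F = v.
Proof. by move=> Fv; apply: get_unique => // u Fu; exact: is_vint_unique Fv. Qed.

Lemma is_vint_linear X (F F' : G -> X) (v v' : X) (k : R) :
  is_vint mu F v -> is_vint mu F' v' ->
  is_vint mu (fun r => k *: F r + F' r) (k *: v + v').
Proof.
move=> Fv Fv' phi phic; have [iF FE] := Fv phi phic; have [iF' FE'] := Fv' phi phic.
have E r : ((phi (k *: F r + F' r))%:E = k%:E * (phi (F r))%:E + (phi (F' r))%:E)%E.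
  by rewrite linearP.
have iZ := integrableZl measurableT k iF.
split; first by under eq_fun do rewrite E; exact: integrableD.
under eq_integral do rewrite E.
by rewrite integralD// integralZl// -FE -FE' linearP.
Qed.

Section Riemann.
Variables (K : set G) (n : nat) (c : 'I_n -> G) (B : 'I_n -> set (borel G)).
Hypotheses (cK : compact K) (mB : forall i, measurable (B i))
  (tB : trivIset setT B) (BK : \big[setU/set0]_(i < n) B i = K).

Definition riemann_sum X (F : G -> X) : X :=
  \sum_(i < n) fine (mu (B i)) *: F (c i).

Lemma riemann_sum_functional X (F : G -> X) (d : R)
    (phi : {linear X -> R^o}) (M v : R) : continuous phi ->
  (forall x, `|phi x| <= M * `|x|) -> 0 <= M ->
  mu.-integrable [set: borel G] (fun r => (phi (F r))%:E) ->
  (forall s, ~ K s -> F s = 0) ->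
  (forall i r, B i r -> `|F r - F (c i)| <= d) ->
  v%:E = (\int[mu]_r (phi (F r))%:E)%E ->
  `|v - phi (riemann_sum F)| <= M * (d * fine (mu K)).
Proof.
move=> phic phiM M0 /integrableP[mphi _] FK Fd vE.
rewrite /riemann_sum linear_sum mulrA.
under eq_bigr do rewrite linearZ.
apply: (riemann_sum_scalar haar_mu cK mB tB BK _ _ _ vE).
- exact/measurable_EFinP.
- by move=> s /FK ->; rewrite linear0.
- move=> i r Br; rewrite -linearB (le_trans (phiM _))//.
  by rewrite ler_wpM2l// Fd.
Qed.

Lemma is_vint_riemann X (F : G -> X) (v : X) (d : R) : is_vint mu F v ->
  (forall s, ~ K s -> F s = 0) ->
  (forall i r, B i r -> `|F r - F (c i)| <= d) ->
  `|v - riemann_sum F| <= d * fine (mu K).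
Proof.
move=> Fv FK Fd; have [phi <- phi1] := norming_functional (v - riemann_sum F).
have phi1' y : `|phi y| <= 1 * `|y| by rewrite mul1r.
have phic := linear_bound_continuous phi1'.
rewrite linearB -[leRHS]mul1r (le_trans (ler_norm _))//.
by have [iF FE] := Fv phi phic; exact: (riemann_sum_functional phic phi1').
Qed.

End Riemann.

Lemma continuous_functional_integrable X (F : G -> X) (K : set G)
    (phi : {linear X -> R^o}) : continuous F -> compact K ->
  (forall s, ~ K s -> F s = 0) -> continuous phi ->
  mu.-integrable [set: borel G] (fun r => (phi (F r))%:E).
Proof.
move=> cF cK FK phic.
have cphiF : continuous (phi \o F : G -> R).
  by move=> s; apply: continuous_comp; [exact: cF|exact: phic].
have [M MK] : exists M, forall s, K s -> `|phi (F s)| <= M.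
  have : compact ((phi \o F : G -> R) @` K).
    by apply: continuous_compact => //; exact: continuous_subspaceT.
  move=> /compact_bounded[M [_ /(_ (M + 1))]]; rewrite ltrDl ltr01 => /(_ isT) MK.
  by exists (M + 1) => s Ks; apply: MK; exists s.
apply: (integrable_compact_support haar_mu (K := K) (M := `|M|)) => //.
- exact: continuous_borel_fun.
- by move=> s /FK ->; rewrite linear0.
- move=> s; have [Ks|/FK ->] := pselect (K s); last by rewrite linear0 normr0.
  by rewrite (le_trans (MK s Ks))// ler_norm.
Qed.

(** Riemann sums over partitions of mesh [1 / n.+1] form a Cauchy sequence: a
    functional that norms the difference of two of them compares both with the
    same scalar integral. *)
Lemma is_vint_exists (X : completeNormedModType R) (F : G -> X) (K : set G) :
  continuous F -> compact K -> (forall s, ~ K s -> F s = 0) ->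
  exists v, is_vint mu F v.
Proof.
move=> cF cK FK.
have part (n : nat) : exists S : X, forall (phi : {linear X -> R^o}) M v,
    continuous phi -> (forall x, `|phi x| <= M * `|x|) -> 0 <= M ->
    v%:E = (\int[mu]_r (phi (F r))%:E)%E ->
    `|v - phi S| <= M * (fine (mu K) / n.+1%:R).
  have [|m [c [B [mB tB BK _ BN]]]] :=
      @compact_partition G K (fun s => [set r | `|F r - F s| <= n.+1%:R^-1]) cK.
    move=> s _; near=> r; rewrite /= distrC; near: r.
    by move: (cF s) => /cvgrPdist_le; apply; rewrite invr_gt0.
  exists (riemann_sum c B F) => phi M v phic phiM M0 vE.
  rewrite [_ / _]mulrC; apply: (riemann_sum_functional cK mB tB BK phic phiM) => //.
  exact: continuous_functional_integrable cF cK FK phic.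
have [S SP] := choice part.
have [m n|v vS] := @harmonic_cauchy _ X S (fine (mu K)).
  have [phi <- phi1] := norming_functional (S m - S n).
  have phi1' y : `|phi y| <= 1 * `|y| by rewrite mul1r.
  have phic := linear_bound_continuous phi1'.
  have iF := continuous_functional_integrable cF cK FK phic.
  have vE : (fine (\int[mu]_r (phi (F r))%:E))%:E = (\int[mu]_r (phi (F r))%:E)%E.
    by rewrite fineK//; exact: integrable_fin_num.
  have := SP m phi 1 _ phic phi1' ler01 vE; have := SP n phi 1 _ phic phi1' ler01 vE.
  rewrite !mul1r linearB /= !ler_norml => /andP[_ le1] /andP[le2 _].
  by move: le1 le2; move: (fine (mu K) / _) (fine (mu K) / _) => *; lra.
exists v => phi phic.
have iF := continuous_functional_integrable cF cK FK phic.
split => //.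
have vE : (fine (\int[mu]_r (phi (F r))%:E))%:E = (\int[mu]_r (phi (F r))%:E)%E.
  by rewrite fineK//; exact: integrable_fin_num.
have [M M0 phiM] := continuous_linear_bound phic.
rewrite -vE; congr EFin; apply/eqP; rewrite -subr_eq0 -normr_le0.
apply: (@le_harmonic _ (M * fine (mu K) + M * fine (mu K))) => n.
have := SP n phi M _ phic phiM (ltW M0) vE.
have := vS n => /(ler_wpM2l (ltW M0)) /(le_trans (phiM _)).
rewrite linearB => le1 le2; rewrite mulrDl -!mulrA.
apply: le_trans (lerD le1 le2).
rewrite [X in _ <= _ + X]distrC.
by rewrite (le_trans _ (ler_normD _ _))// subrKA.
Unshelve. all: by end_near. Qed.

(** The integral is a limit of Riemann sums, which are conic combinations of
    values of the integrand. *)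
Lemma is_vint_closed_cone X (F : G -> X) (v : X) (K : set G) (P : set X) :
  is_vint mu F v -> continuous F -> compact K ->
  (forall s, ~ K s -> F s = 0) -> closed P -> P 0 ->
  (forall x y, P x -> P y -> P (x + y)) ->
  (forall k x, 0 <= k -> P x -> P (k *: x)) -> (forall r, P (F r)) -> P v.
Proof.
move=> Fv cF cK FK clP P0 PD PZ PF; apply: clP; apply/closure_approx => e e0.
have mK0 : 0 <= fine (mu K) by exact: fine_ge0.
pose d := e / (fine (mu K) + 1) / 2.
have d0 : 0 < d by rewrite !divr_gt0// ltr_wpDl.
have [|m [c [B [mB tB BK _ BN]]]] :=
    @compact_partition G K (fun s => [set r | `|F r - F s| <= d]) cK.
  move=> s _; near=> r; rewrite /= distrC; near: r.
  by move: (cF s) => /cvgrPdist_le; apply.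
exists (riemann_sum c B F).
  by apply: (big_ind P) => // i _; apply: PZ => //; exact: fine_ge0.
apply: (le_lt_trans (is_vint_riemann cK mB tB BK Fv FK BN)).
have dE : d * (fine (mu K) + 1) = e / 2.
  by rewrite /d mulrAC divfK// gt_eqF// ltr_wpDl.
by move: dE d0 e0; clear; lra.
Unshelve. all: by end_near. Qed.

End WeakIntegral.

(** * Compactly supported functions in the weighted norm *)

Section CompactlySupported.
Context {R : realType} {G : lcgroupType}.

Lemma Cc_ext (X : normedModType R) (f g : Cc G X) : f =1 g -> f = g.
Proof. by move=> fg; apply: val_inj; exact/funext. Qed.

Lemma Cc_linearE (X : normedModType R) k (f g : Cc G X) s :
  (k *: f + g) s = k *: f s + g s.
Proof. by rewrite (GRing.valD (k *: f) g) (GRing.valZ k f). Qed.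

Lemma Cc_subE (X : normedModType R) (f g : Cc G X) s : (f - g) s = f s - g s.
Proof. by rewrite addrC -scaleN1r Cc_linearE scaleN1r addrC. Qed.

Lemma Cc_scaleE (X : normedModType R) k (f : Cc G X) s : (k *: f) s = k *: f s.
Proof. by rewrite (GRing.valZ k f). Qed.

Lemma Cc_sumE (X : normedModType R) n (f : 'I_n -> Cc G X) s :
  (\sum_(i < n) f i) s = \sum_(i < n) f i s.
Proof.
by elim/big_ind2 : _ => // _ f1 _ g1 <- <-; rewrite (GRing.valD f1 g1).
Qed.

Lemma Cc_tensor_subproof (X : normedModType R) (z : Cc G R^o) (a : X) :
  (fun s => z s *: a) \in @Cc_pred R G X.
Proof.
apply/asboolP; split.
  by move=> s; apply: cvgZr_tmp; exact: Cc_continuous.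
by apply: compact_closure_sub (Cc_compact z) => s /=; apply: contra_neq => ->; rewrite scale0r.
Qed.

Definition Cc_tensor (X : normedModType R) (z : Cc G R^o) (a : X) : Cc G X :=
  MkCc (Cc_tensor_subproof z a).

Lemma compact_bump (K : set G) : compact K ->
  exists2 h : Cc G R^o, forall s, 0 <= h s & forall s, K s -> 1 <= h s.
Proof.
move=> cK.
have bump s : exists h : Cc G R^o, (forall t, 0 <= h t) /\ h s = 1.
  have [h [hc h0 h1 _ hK]] := @point_bump R G s setT filterT.
  by have hP : (h : G -> R^o) \in @Cc_pred R G R^o; [exact/asboolP|exists (MkCc hP)].
have [b bP] := choice bump.
have [|n [c [B [_ _ BK _ BN]]]] :=
    @compact_partition G K (fun s => [set t | 1 / 2 <= b s t]) cK.
  move=> s _; have /cvgrPdist_le := @Cc_continuous R G R^o (b s) s.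
  rewrite (bP s).2 => /(_ _ (divr_gt0 ltr01 (ltr0n _ 2))).
  by apply: filterS => t /=; rewrite ler_norml => /andP[_]; lra.
exists (2 *: \sum_(i < n) b (c i)) => s.
  rewrite Cc_scaleE mulr_ge0// Cc_sumE sumr_ge0// => i _; exact: (bP _).1.
rewrite -BK => /bigsetU_ordP[i Bs]; rewrite Cc_scaleE Cc_sumE (bigD1 i)//=.
have := BN i s Bs; rewrite /= /GRing.scale/=.
have : 0 <= \sum_(j < n | j != i) b (c j) s.
  by apply: sumr_ge0 => j _; exact: (bP _).1.
move: (\sum_(j < n | _) _) => y; lra.
Qed.
End CompactlySupported.

Section WeightedNorm.
Context {R : realType} {G : lcgroupType} {A L : normedModType R}.
Variable mu : {measure set (borel G) -> \bar R}.
Hypothesis haar_mu : left_haar_measure mu.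
Variables (w : G -> R) (iota : {linear Cc G A -> L}).
Hypothesis weight_w : weight w.
Hypothesis iota_norm : forall f : Cc G A,
  (`|iota f|)%:E = (\int[mu]_s (`|f s| * w s)%:E)%E.

Let w0 s : 0 <= w s. Proof. exact: weight_ge0. Qed.

Lemma weighted_measurable (f : Cc G A) :
  measurable_fun [set: borel G] ((fun s => `|f s| * w s) : borel G -> R).
Proof.
apply: measurable_funM; last exact: weight_measurable.
apply: continuous_borel_fun => s; apply: cvg_norm; exact: Cc_continuous.
Qed.

Lemma iota_norm_le (f g : Cc G A) (M : R) : 0 <= M ->
  (forall s, `|f s| <= M * `|g s|) -> `|iota f| <= M * `|iota g|.
Proof.
move=> M0 fg; rewrite -lee_fin EFinM !iota_norm.
have /measurable_EFinP mf := weighted_measurable f.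
have /measurable_EFinP mg := weighted_measurable g.
rewrite -ge0_integralZl_EFin//; last by move=> s _; rewrite lee_fin mulr_ge0.
apply: ge0_le_integral => //; first by move=> s _; rewrite lee_fin mulr_ge0.
- exact: measurable_funeM.
- by move=> s _; rewrite -EFinM lee_fin mulrA ler_wpM2r.
Qed.

Lemma iota_norm_shift (r : G) (f g : Cc G A) :
  (forall s, g s = f (r^-1 * s)%g) ->
  (`|iota g|)%:E = (\int[mu]_s (`|f s| * w (r * s)%g)%:E)%E.
Proof.
move=> gf; have /measurable_EFinP mg := weighted_measurable g.
rewrite iota_norm -(haar_integral_left_mulg haar_mu r mg); last first.
  by move=> s; rewrite /= lee_fin mulr_ge0.
by apply: eq_integral => s _ /=; rewrite gf mulKg.
Qed.

Lemma iota_norm_shift_le (r : G) (f g : Cc G A) :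
  (forall s, g s = f (r^-1 * s)%g) -> `|iota g| <= w r * `|iota f|.
Proof.
move=> gf; rewrite -lee_fin (iota_norm_shift gf) EFinM iota_norm.
have mf := weighted_measurable f.
have /measurable_EFinP mf' := mf.
rewrite -ge0_integralZl_EFin//; last by move=> s _; rewrite lee_fin mulr_ge0.
apply: ge0_le_integral => //.
- by move=> s _; rewrite lee_fin mulr_ge0.
- apply/measurable_EFinP; apply: measurable_funM.
    apply: continuous_borel_fun => s; apply: cvg_norm; exact: Cc_continuous.
  apply: (@measurableT_comp _ _ _ (borel G) (borel G) R w setT ( *%g r)).
    exact: weight_measurable.
  by apply: continuous_borel_map; exact: left_mulg_continuous.
- exact: measurable_funeM.
- move=> s _; rewrite -EFinM lee_fin mulrCA ler_wpM2l//.
  exact: weight_subM.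
Qed.

(** The weight has finite integral over compact sets because some function
    bounded below on the set has finite norm. *)
Lemma iota_norm_compact (K : set G) : compact K ->
  exists2 M : R, 0 <= M & forall (f : Cc G A) (e : R),
    (forall s, ~ K s -> f s = 0) -> (forall s, `|f s| <= e) -> `|iota f| <= M * e.
Proof.
move=> cK; have [h h0 h1] := compact_bump (R := R) cK.
have [[a a0]|/forallNP A0] := pselect (exists a : A, a != 0); last first.
  exists 0 => // f e _ _; rewrite mul0r (_ : f = 0) ?linear0 ?normr0//.
  by apply: Cc_ext => s; have /negP/negPn/eqP := A0 (f s).
have na : 0 < `|a| by rewrite normr_gt0.
exists (`|iota (Cc_tensor h a)| / `|a|); first by rewrite divr_ge0.
move=> f e fK fe.
have e0 : 0 <= e by exact: le_trans (normr_ge0 _) (fe 1%g).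
rewrite -mulrA mulrC [_^-1 * _]mulrC; apply: iota_norm_le; first by rewrite divr_ge0.
move=> s; have [Ks|/fK ->] := pselect (K s); last first.
  by rewrite normr0 mulr_ge0// divr_ge0.
rewrite /= normrZ mulrCA divfK ?gt_eqF// (le_trans (fe s))//.
by rewrite ler_peMl// ger0_norm ?h0// h1.
Qed.

(** Submultiplicativity gives [w r <= w (r * s) * w s^-1]. Averaging over a set
    of positive measure on which [w s^-1] is bounded dominates [w] by the norms
    of the translates of one function. *)
Lemma weight_le_shift (shift : G -> Cc G A -> Cc G A) (a : A) : a != 0 ->
  (forall r h s, shift r h s = h (r^-1 * s)%g) ->
  exists (h : Cc G A) (M : R), forall r, w r <= M * `|iota (shift r h)|.
Proof.
move=> a0 shiftE.
have na : 0 < `|a| by rewrite normr_gt0.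
have [K K1 cK] := compact_nbhs (1%g : G).
have muK : (0 < mu K)%E.
  apply: (@lt_le_trans _ _ (mu (K°))).
    by apply: (haar_open_gt0 haar_mu); [exact: open_interior|exists 1%g].
  apply: le_measure; rewrite ?inE; last exact: interior_subset.
  - by apply: borel_open; exact: open_interior.
  - exact: borel_compact.
pose E (n : nat) : set (borel G) := K `&` [set s | w (s^-1)%g <= n%:R].
have mwV : measurable_fun [set: borel G] ((fun s => w (s^-1)%g) : borel G -> R).
  apply: (@measurableT_comp _ _ _ (borel G) (borel G) R w setT (fun s : G => s^-1)%g).
    exact: weight_measurable.
  by apply: continuous_borel_map; exact: invg_continuous.
have mE n : measurable (E n).
  apply: measurableI; first exact: borel_compact.
  rewrite -[X in measurable X]setTI.
  by apply: measurable_fun_le => //; exact: measurable_cst.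
have [n nE] : exists n, (0 < mu (E n))%E.
  apply: contrapT => /forallNP E0; move: muK; apply/negP; rewrite -leNgt.
  have KE : K `<=` \bigcup_n E n.
    move=> s Ks; exists (Num.truncn (w (s^-1)%g)).+1 => //; split => //=.
    by rewrite ltW// truncnS_gt.
  apply: (le_trans (measure_sigma_subadditive mu mE (borel_compact cK) KE)).
  rewrite eseries0// => n _ _; apply/eqP; rewrite eq_le measure_ge0 andbT leNgt.
  exact/negP/E0.
have muE : mu (E n) \is a fin_num.
  rewrite ge0_fin_numE// (le_lt_trans _ (haar_compact haar_mu cK))//.
  by apply: le_measure; rewrite ?inE//; [exact: borel_compact|move=> s []].
have m0 : 0 < fine (mu (E n)) by rewrite fine_gt0// nE -ge0_fin_numE.
have [z z0 z1] := compact_bump (R := R) cK.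
pose h := Cc_tensor z a.
exists h, (n%:R / (fine (mu (E n)) * `|a|)) => r.
rewrite mulrAC ler_pdivlMr ?mulr_gt0// [fine _ * _]mulrC mulrA.
have hshift s : shift r h s = h (r^-1 * s)%g by exact: shiftE.
rewrite -lee_fin [leRHS]EFinM (iota_norm_shift hshift) EFinM fineK//.
have mwr : measurable_fun [set: borel G] ((fun s => w (r * s)%g) : borel G -> R).
  apply: (@measurableT_comp _ _ _ (borel G) (borel G) R w setT ( *%g r)).
    exact: weight_measurable.
  by apply: continuous_borel_map; exact: left_mulg_continuous.
have mint : measurable_fun [set: borel G] (fun s => (`|h s| * w (r * s)%g)%:E : \bar R).
  apply/measurable_EFinP; apply: measurable_funM => //.
  by apply: continuous_borel_fun => s; apply: cvg_norm; exact: Cc_continuous.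
rewrite -ge0_integralZl_EFin//; last by move=> s _; rewrite lee_fin mulr_ge0.
rewrite [leLHS](_ : _ = \int[mu]_(s in E n) cst (w r * `|a|)%:E s)%E; last first.
  by rewrite integral_cst.
apply: (@le_trans _ _ (\int[mu]_(s in E n) (n%:R%:E * (`|h s| * w (r * s)%g)%:E))%E).
  apply: ge0_le_integral => //.
  - by move=> s _; rewrite lee_fin mulr_ge0.
  - by apply: measurable_funTS; exact: measurable_funeM.
  - move=> s [Ks /= ws]; rewrite -EFinM lee_fin.
    have ha : `|a| <= `|h s|.
      by rewrite /= normrZ ler_peMl// ger0_norm ?z0// z1.
    have wr : w r <= n%:R * w (r * s)%g.
      rewrite -{1}(mulgK s r) (le_trans (weight_subM weight_w _ _))// mulrC.
      by rewrite ler_wpM2r.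
    rewrite mulrCA mulrC; exact: ler_pM.
apply: ge0_subset_integral => //; first exact: measurable_funeM.
by move=> s _; rewrite -EFinM lee_fin !mulr_ge0.
Qed.
End WeightedNorm.

(** * The integrated form of the left regular representation *)

Section DenseBounds.
Context {R : realType}.

Lemma dense_le (X : topologicalType) (S : set X) (f g : X -> R) :
  dense S -> continuous f -> continuous g -> (forall x, S x -> f x <= g x) ->
  forall x, f x <= g x.
Proof.
move=> dS cf cg fg x; rewrite leNgt; apply/negP => gfx.
pose U := [set y | 0 < f y - g y].
have oU : open U.
  apply: (@open_comp _ _ (fun y => f y - g y) [set r | 0 < r]); last exact: open_gt.
  by move=> y _; apply: cvgB; [exact: cf|exact: cg].
have [|y [/= Uy Sy]] := dS U _ oU; first by exists x; rewrite /U /= subr_gt0.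
by move: Uy; rewrite /U/= subr_gt0 ltNge fg.
Qed.

Lemma dense_norm_le (X Y : normedModType R) (S : set X) (T : X -> Y) (M : R) :
  dense S -> continuous T -> (forall x, S x -> `|T x| <= M * `|x|) ->
  forall x, `|T x| <= M * `|x|.
Proof.
move=> dS cT TM; apply: dense_le dS _ _ TM => x.
  by apply: cvg_norm; exact: cT.
by apply: cvgM; [exact: cvg_cst|apply: cvg_norm; exact: cvg_id].
Qed.

Lemma bop_subE (X : normedModType R) (S T : bop X) x : (S - T) x = S x - T x.
Proof. by rewrite -scaleN1r bop_addE bop_scaleE scaleN1r. Qed.

End DenseBounds.

Section Regular.
Context {R : realType} {A : preBanachAlgType R} {G : lcgroupType}.
Variable mu : {measure set (borel G) -> \bar R}.
Hypothesis haar_mu : left_haar_measure mu.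
Variables (alpha : dynsys A G) (Ma : R).
Hypothesis Ma0 : 0 <= Ma.
Hypothesis alphaM : forall s a, `|alpha s a| <= Ma * `|a|.
Variable w : G -> R.
Hypothesis weight_w : weight w.
Variables (L : preCompleteAlgType R) (iota : {linear Cc G A -> L}).
Hypothesis beurling_L : beurling_algebra alpha mu w iota.
Variable rho : covrep alpha L.
Hypothesis regular_rho : left_regular_rep iota rho.

Let iota_norm := ba_norm beurling_L.

Lemma crpi_bound a x : `|crpi rho a x| <= Ma * `|a| * `|x|.
Proof.
move: x; apply: (dense_norm_le (ba_dense beurling_L)
  (@bop_continuous _ _ (crpi rho a))) => _ [h _ <-].
rewrite (lr_pi regular_rho).
apply: (iota_norm_le weight_w iota_norm); first by rewrite mulr_ge0.
by move=> s; rewrite /= (le_trans (norm_amul _ _))// ler_wpM2r.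
Qed.

Lemma crU_bound r x : `|crU rho r x| <= w r * `|x|.
Proof.
move: x; apply: (dense_norm_le (ba_dense beurling_L)
  (@bop_continuous _ _ (crU rho r))) => _ [h _ <-].
rewrite (lr_U regular_rho).
exact: (iota_norm_shift_le haar_mu weight_w iota_norm).
Qed.

Let F (f : Cc G A) x r := crpi rho (f r) (crU rho r x).

Lemma crpiB a b x : crpi rho (a - b) x = crpi rho a x - crpi rho b x.
Proof.
by rewrite linearB bop_subE.
Qed.

Lemma integrand_continuous f x : continuous (F f x).
Proof.
move=> r0; apply/subr_cvg0; apply: norm_cvg0.
apply: (@squeeze_cvgr _ _ _ R (cst 0)
  (fun r => Ma * `|f r - f r0| * `|crU rho r x| +
    Ma * `|f r0| * `|crU rho r x - crU rho r0 x|)).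
- apply: nearW => r /=; rewrite normr_ge0 /= /F.
  rewrite -(subrKA (crpi rho (f r0) (crU rho r x))) -crpiB -linearB.
  by rewrite (le_trans (ler_normD _ _))// lerD// crpi_bound.
- exact: cvg_cst.
- have cU := @crU_continuous _ _ _ _ _ rho x r0.
  rewrite -[0](_ : Ma * 0 * `|crU rho r0 x| + Ma * `|f r0| * 0 = 0); last first.
    by rewrite !mulr0 mul0r addr0.
  apply: cvgD; apply: cvgM.
  + apply: cvgM; first exact: cvg_cst.
    by rewrite -(@normr0 _ A); apply: cvg_norm; apply/subr_cvg0; exact: Cc_continuous.
  + exact: cvg_norm.
  + exact: cvg_cst.
  + by rewrite -(@normr0 _ L); apply: cvg_norm; exact/subr_cvg0.
Qed.

Lemma integrand_support (f : Cc G A) : exists2 K, compact K &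
  forall x s, ~ K s -> f s = 0 /\ F f x s = 0.
Proof.
have [K cK fK] := Cc_support f; exists K => // x s /fK fs0.
by rewrite /F fs0; have := crpiB 0 0 (crU rho s x); rewrite !subrr.
Qed.

Lemma integrated_is_vint f x : is_vint mu (F f x) (integrated mu rho f x).
Proof.
have [K cK FK] := integrand_support f.
have [v vF] := is_vint_exists haar_mu (@integrand_continuous f x) cK
  (fun s nKs => (FK x s nKs).2).
by rewrite /integrated (vintE vF).
Qed.

Lemma integrated_le f x :
  `|integrated mu rho f x| <= Ma * `|iota f| * `|x|.
Proof.
pose k r := Ma * `|x| * (`|f r| * w r).
have /measurable_EFinP mf := weighted_measurable weight_w f.
apply: (is_vint_norm_le (integrated_is_vint f x) (k := k)).
- by apply: measurable_funM => //; exact/measurable_EFinP.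
- move=> r; rewrite /k -mulrA mulrCA mulrA [X in _ <= X](_ : _ = Ma * `|f r| * (w r * `|x|)).
    rewrite (le_trans (crpi_bound _ _))// ler_wpM2l ?mulr_ge0//; exact: crU_bound.
  by rewrite !mulrA [_ * Ma]mulrC; lra.
- rewrite /k; under eq_integral do rewrite EFinM.
  rewrite ge0_integralZl_EFin//.
  + by rewrite -iota_norm -EFinM lee_fin mulrAC.
  + by move=> s _; rewrite lee_fin mulr_ge0// (weight_ge0 weight_w).
  + by rewrite mulr_ge0.
Qed.

Lemma integrated_linear f : linear (integrated mu rho f).
Proof.
move=> k x y; apply: (is_vint_unique (integrated_is_vint _ _)).
have := is_vint_linear k (integrated_is_vint f x) (integrated_is_vint f y).
congr is_vint; apply/funext => r.
by rewrite /F !linearP.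
Qed.

Lemma integrated_linearl k f g x : integrated mu rho (k *: f + g) x =
  k *: integrated mu rho f x + integrated mu rho g x.
Proof.
apply: (is_vint_unique (integrated_is_vint _ _)).
have := is_vint_linear k (integrated_is_vint f x) (integrated_is_vint g x).
congr is_vint; apply/funext => r.
by rewrite /F Cc_linearE linearP bop_addE bop_scaleE.
Qed.

Lemma integrated_pos f x :
  Cc_pos G A f -> vpos x -> vpos (integrated mu rho f x).
Proof.
move=> f0 x0; have [K cK FK] := integrand_support f.
have F0 r : vpos (F f x r).
  have [pi0 U0] := lr_positive regular_rho.
  have := pi0 (crpi rho (f r)); apply; first by exists (f r).
  by exists (crU rho r x) => //; apply: (U0 r); exists x.
apply: (is_vint_closed_cone haar_mu (integrated_is_vint f x)
  (@integrand_continuous f x) cK (fun s nKs => (FK x s nKs).2)) => //.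
- by rewrite (ba_pos beurling_L); exact: closed_closure.
- by rewrite -(scale0r (F f x 1%g)); apply: vposZ.
- exact: vposD.
- exact: vposZ.
Qed.

End Regular.

(** * Approximate right identities *)

Lemma amul0l (R : realType) (A : assocAlgType R) (a : A) : 0 ** a = 0.
Proof. by rewrite -[X in X ** a](scale0r 0) amulZl scale0r. Qed.

Section Bumps.
Context {R : realType} {G : lcgroupType}.
Variable mu : {measure set (borel G) -> \bar R}.
Hypothesis haar_mu : left_haar_measure mu.

Lemma Cc_bounded (X : normedModType R) (f : Cc G X) :
  exists2 M : R, 0 <= M & forall s, `|f s| <= M.
Proof.
have [K cK fK] := Cc_support f.
have : compact [set `|f s| | s in K].
  apply: continuous_compact => //; apply: continuous_subspaceT => s.
  by apply: cvg_norm; exact: Cc_continuous.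
move=> /compact_bounded[M [_ /(_ (`|M| + 1))]].
rewrite (le_lt_trans (ler_norm M)) ?ltrDl// => /(_ isT) MK.
exists (`|M| + 1); first by rewrite addr_ge0.
move=> s; have [Ks|/fK ->] := pselect (K s); last by rewrite normr0 addr_ge0.
by rewrite -[`|f s|]normr_id; apply: MK; exists s.
Qed.

Lemma Cc_scalar_integrable (z : Cc G R^o) :
  mu.-integrable [set: borel G] (fun s => (z s)%:E).
Proof.
have [K cK zK] := Cc_support z; have [M _ zM] := Cc_bounded z.
apply: (integrable_compact_support haar_mu cK (M := M)) => //.
by apply: continuous_borel_fun; exact: (@Cc_continuous R G R^o z).
Qed.

Lemma normalized_bump (V : set G) : nbhs (1%g : G) V ->
  exists z : Cc G R^o, [/\ forall s, 0 <= z s, forall s, z (s^-1)%g = z s,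
    forall s, ~ V s -> z s = 0 & (\int[mu]_s (z s)%:E = 1)%E].
Proof.
move=> V1; have [h [h0 h1 hV hN]] := symmetric_bump (R := R) V1.
have ih := Cc_scalar_integrable h.
have hfin := integrable_fin_num measurableT ih.
pose I := fine (\int[mu]_s (h s)%:E)%E.
have IE : (I%:E = \int[mu]_s (h s)%:E)%E by rewrite fineK.
have ch : continuous (h : G -> R) := @Cc_continuous R G R^o h.
have mh : measurable_fun [set: borel G] (fun s => (h s)%:E : \bar R).
  by apply/measurable_EFinP; exact: continuous_borel_fun.
have I0 : 0 < I.
  pose W := [set s | h 1%g / 2 < h s].
  have oW : open W.
    apply: (@open_comp _ _ (h : G -> R) [set r | h 1%g / 2 < r]); last exact: open_gt.
    by move=> s _; exact: ch.
  have W0 : (0 < mu W)%E.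
    apply: (haar_open_gt0 haar_mu oW); exists 1%g.
    by rewrite /W/= ltr_pdivrMr// mulr_natr mulr2n ltrDl.
  rewrite -lte_fin IE; apply: (@lt_le_trans _ _ ((h 1%g / 2)%:E * mu W)%E).
    by rewrite mule_gt0// lte_fin divr_gt0.
  rewrite -(integral_cst mu (borel_open oW) (h 1%g / 2)%:E).
  apply: (@le_trans _ _ (\int[mu]_(s in W) (h s)%:E)%E).
    apply: ge0_le_integral => //.
    - exact: borel_open.
    - by move=> s _; rewrite lee_fin ltW// divr_gt0.
    - exact: measurable_funTS.
    - by move=> s /= /ltW; rewrite lee_fin.
  apply: ge0_subset_integral => //; first exact: borel_open.
  by move=> s _; rewrite lee_fin.
exists (I^-1 *: h); split.
- by move=> s; rewrite Cc_scaleE mulr_ge0// invr_ge0 ltW.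
- by move=> s; rewrite !Cc_scaleE hV.
- by move=> s /hN hs; rewrite Cc_scaleE hs scaler0.
- under eq_integral do rewrite Cc_scaleE EFinM.
  rewrite ge0_integralZl_EFin//; last by rewrite invr_ge0 ltW.
    by rewrite -IE -EFinM mulVf// gt_eqF.
  by move=> s _; rewrite lee_fin.
Qed.

Lemma directed_upper_bound (I : Type) (le : I -> I -> Prop) n (i : 'I_n -> I) :
  directed le -> exists j, forall k, le (i k) j.
Proof.
move=> [[j0 _] lexx letr ledir]; elim: n i => [|n IH] i; first by exists j0 => -[].
have [j1 j1P] := IH (fun k => i (lift ord_max k)).
have [j [le1 le2]] := ledir j1 (i ord_max).
exists j => k; case: (unliftP ord_max k) => [k' ->|->//].
exact: letr (j1P k') le1.
Qed.

(** Boundedness of the net reduces the compact range of [y] to finitely many of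
    its values, and for these a common index exists. *)
Lemma approx_right_id_uniform (A : preBanachAlgType R) (M : R) (S : set A)
    (y : Cc G A) (e : R) :
  has_bounded_approx_right_id M S -> 0 < e ->
  exists a, [/\ S a, `|a| <= M & forall s, `|y s ** a - y s| <= e].
Proof.
move=> [I [le [u [dirle Su uM uid]]]] e0; have [[j0 _] _ _ _] := dirle.
have M0 : 0 <= M by exact: le_trans (normr_ge0 _) (uM j0).
have [K cK yK] := Cc_support y.
pose d := e / (M + 2).
have d0 : 0 < d by rewrite divr_gt0// ltr_wpDl.
have dE : d * (M + 2) = e by rewrite divfK// gt_eqF// ltr_wpDl.
have [|n [c [B [_ _ BK _ BN]]]] :=
    @compact_partition G K (fun s => [set t | `|y t - y s| <= d]) cK.
  move=> s _; near=> t; rewrite /= distrC; near: t.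
  by have /cvgrPdist_le := @Cc_continuous _ _ _ y s; apply.
have [i ui] : exists i, forall k : 'I_n, `|y (c k) ** u i - y (c k)| <= d.
  have {}uid k : exists i, forall i', le i i' -> `|y (c k) ** u i' - y (c k)| <= d.
    have [i ui] := uid (y (c k)) d d0; exists i => i' /ui; exact: ltW.
  have [i0 i0P] := choice uid.
  have [i iP] := directed_upper_bound i0 dirle.
  by exists i => k; apply: i0P; exact: iP.
exists (u i); split => // s.
have [Ks|/yK ->] := pselect (K s); last first.
  by rewrite amul0l subr0 normr0 ltW.
have /bigsetU_ordP[k Bks] : (\big[setU/set0]_(i < n) B i) s by rewrite BK.
have yd : `|y s - y (c k)| <= d := BN k s Bks.
have -> : y s ** u i - y s = (y s - y (c k)) ** u i + (y (c k) ** u i - y (c k)) + (y (c k) - y s).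
  by rewrite amulDl amulNl !subrKA.
rewrite (le_trans (ler_normD _ _))// -dE mulrDr mulr_natr mulr2n [leRHS]addrA.
apply: lerD; last by rewrite distrC.
rewrite (le_trans (ler_normD _ _))// lerD//.
by rewrite (le_trans (norm_amul _ _))// ler_pM.
Unshelve. all: by end_near. Qed.
End Bumps.

Section Approximation.
Context {R : realType} {A : preBanachAlgType R} {G : lcgroupType}.
Variables (alpha : dynsys A G) (Ma : R).
Hypothesis alphaM : forall s a, `|alpha s a| <= Ma * `|a|.

Lemma dynsys_linear s : linear (alpha s).
Proof. exact: pos_aut_linear (act_aut alpha s). Qed.

Lemma dynsysB s a b : alpha s (a - b) = alpha s a - alpha s b.
Proof.
by rewrite addrC -scaleN1r (dynsys_linear s (-1) b a) scaleN1r addrC.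
Qed.

Lemma dynsys0 s : alpha s 0 = 0.
Proof. by have := dynsysB s 0 0; rewrite !subrr. Qed.

Lemma dynsys1 a : alpha 1%g a = a.
Proof.
have [g gK _] := pos_aut_bij (act_aut alpha 1%g).
by apply: (can_inj gK); rewrite -act_mul mulg1.
Qed.

Lemma dynsysK s : cancel (alpha s^-1%g) (alpha s).
Proof. by move=> a; rewrite -act_mul mulgV dynsys1. Qed.

Lemma twist_continuous (t : G -> G) (f : Cc G A) : continuous t ->
  continuous (fun s => alpha (t s) (f s)).
Proof.
move=> ct s0; apply/subr_cvg0; apply: norm_cvg0.
apply: (@squeeze_cvgr _ _ _ R (cst 0) (fun s => Ma * `|f s - f s0| +
  `|alpha (t s) (f s0) - alpha (t s0) (f s0)|)).
- apply: nearW => s /=; rewrite normr_ge0 /=.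
  rewrite -(subrKA (alpha (t s) (f s0))) -dynsysB.
  by rewrite (le_trans (ler_normD _ _))// lerD2r.
- exact: cvg_cst.
- rewrite -[0](_ : Ma * 0 + 0 = 0); last by rewrite mulr0 addr0.
  apply: cvgD.
    apply: cvgM; first exact: cvg_cst.
    by rewrite -(@normr0 _ A); apply: cvg_norm; apply/subr_cvg0; exact: Cc_continuous.
  rewrite -(@normr0 _ A); apply: cvg_norm; apply/subr_cvg0.
  apply: (@continuous_comp _ _ _ t (alpha^~ (f s0))); first exact: ct.
  exact: act_continuous.
Qed.

Lemma twist_subproof (t : G -> G) (f : Cc G A) : continuous t ->
  (fun s => alpha (t s) (f s)) \in @Cc_pred R G A.
Proof.
move=> ct; apply/asboolP; split; first exact: twist_continuous.
apply: compact_closure_sub (Cc_compact f) => s /=.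
by apply: contra_neq => ->; exact: dynsys0.
Qed.

(** Conjugation by [twist] turns the integrated form of the left regular
    representation into left multiplication of the twisted convolution. *)
Definition twist (f : Cc G A) : Cc G A :=
  MkCc (@twist_subproof id f (fun s => @cvg_id _ (nbhs s))).

Definition untwist (f : Cc G A) : Cc G A :=
  MkCc (@twist_subproof _ f (@invg_continuous G)).

Lemma untwistK : cancel untwist twist.
Proof. by move=> f; apply: Cc_ext => s /=; rewrite dynsysK. Qed.

Lemma twistB f g : twist (f - g) = twist f - twist g.
Proof.
apply: Cc_ext => s.
by rewrite Cc_subE -[LHS]/(alpha s ((f - g) s)) Cc_subE dynsysB.
Qed.

Lemma twist_pos f : Cc_pos G A f -> Cc_pos G A (twist f).
Proof.
by move=> f0 s; apply: (pos_aut_pos (act_aut alpha s)); exists (f s).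
Qed.

End Approximation.

Section RegularApproximation.
Context {R : realType} {A : preBanachAlgType R} {G : lcgroupType}.
Variable mu : {measure set (borel G) -> \bar R}.
Hypothesis haar_mu : left_haar_measure mu.
Variables (alpha : dynsys A G) (Ma : R).
Hypothesis Ma0 : 0 <= Ma.
Hypothesis alphaM : forall s a, `|alpha s a| <= Ma * `|a|.
Variable w : G -> R.
Hypothesis weight_w : weight w.
Variables (L : preCompleteAlgType R) (iota : {linear Cc G A -> L}).
Hypothesis beurling_L : beurling_algebra alpha mu w iota.
Variable rho : covrep alpha L.
Hypothesis regular_rho : left_regular_rep iota rho.

Let iota_norm := ba_norm beurling_L.

Lemma tensor_norm_le (z : Cc G R^o) (a : A) (V : set G) (B : R) :
  (forall s, 0 <= z s) -> (forall s, ~ V s -> z s = 0) ->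
  (\int[mu]_s (z s)%:E = 1)%E -> 0 <= B -> (forall s, V s -> w s <= B) ->
  `|iota (Cc_tensor z a)| <= `|a| * B.
Proof.
move=> z0 zV zI B0 wB; rewrite -lee_fin iota_norm.
have mz : measurable_fun [set: borel G] (fun s => (z s)%:E : \bar R).
  apply/measurable_EFinP; apply: continuous_borel_fun.
  exact: (@Cc_continuous R G R^o z).
rewrite -[leRHS]mule1 -zI -ge0_integralZl_EFin//; first last.
- by rewrite mulr_ge0.
- by move=> s _; rewrite lee_fin.
have /measurable_EFinP mf := weighted_measurable weight_w (Cc_tensor z a).
apply: ge0_le_integral => //.
- by move=> s _; rewrite lee_fin mulr_ge0// (weight_ge0 weight_w).
- exact: measurable_funeM.
move=> s _; rewrite -EFinM lee_fin /= normrZ (ger0_norm (z0 s)).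
have [Vs|/zV ->] := pselect (V s); last by rewrite !(mul0r, mulr0).
by rewrite -mulrA [leRHS]mulrC ler_wpM2l// ler_wpM2l// wB.
Qed.

Lemma compact_mulg (K K' : set G) : compact K -> compact K' ->
  compact [set (s * t)%g | s in K & t in K'].
Proof.
move=> cK cK'.
have -> : [set (s * t)%g | s in K & t in K'] =
    (fun p : G * G => (p.1 * p.2)%g) @` (K `*` K').
  apply/seteqP; split => [_ [s Ks [t Kt <-]]|_ [[s t] /= [Ks Kt] <-]].
    by exists (s, t).
  by exists s => //; exists t.
apply: continuous_compact; last exact: compact_setX.
by apply: continuous_subspaceT; exact: mulg_continuous.
Qed.

Lemma symmetric_shift (z : Cc G R^o) : (forall s, z (s^-1)%g = z s) ->
  forall r s, z (r^-1 * s)%g = z (s^-1 * r)%g.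
Proof. by move=> zV r s; rewrite -zV invgM invgK. Qed.

(** Since [z] lives near the unit, only sample points [c i] close to [s]
    contribute to the Riemann sum, and there [f (c i)] may be replaced by [f s].
    What remains is [Z], a Riemann sum for the integral of [z], times the value of
    the untwisted [f] at [s]. *)
Lemma untwist_shift_approx (f : Cc G A) (a : A) (z : Cc G R^o) (M eta : R)
    (s : G) n (c : 'I_n -> G) (m : 'I_n -> R) (Z : R) :
  (forall t, 0 <= z t) -> (forall t, z (t^-1)%g = z t) ->
  (forall v, z v != 0 -> forall t, `|f (t * v)%g - f t| <= eta) ->
  `|a| <= M -> `|alpha s^-1%g (f s) ** a - alpha s^-1%g (f s)| <= eta ->
  (forall i, 0 <= m i) ->
  Z = \sum_(i < n) m i * z ((c i)^-1 * s)%g ->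
  `|\sum_(i < n) m i *: (alpha s^-1%g (f (c i)) ** (z ((c i)^-1 * s)%g *: a))
    - alpha s^-1%g (f s)| <=
  Z * ((Ma * M + 1) * eta) + `|Z - 1| * `|alpha s^-1%g (f s)|.
Proof.
move=> z0 zV feta aM aeta m0 ZE; set y := alpha s^-1%g (f s).
rewrite -(subrKA (Z *: y)) (le_trans (ler_normD _ _))// lerD//; last first.
  by rewrite -{2}[y]scale1r -scalerBl normrZ.
rewrite ZE scaler_suml -sumrB (le_trans (ler_norm_sum _ _ _))// mulr_suml.
apply: ler_sum => i _.
have zi0 := z0 ((c i)^-1 * s)%g.
rewrite amulZr scalerA -scalerBr normrZ ger0_norm ?mulr_ge0//.
have [zs0|zs] := eqVneq (z ((c i)^-1 * s)%g) 0.
  by rewrite zs0 !(mulr0, mul0r).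
rewrite ler_wpM2l ?mulr_ge0//.
have fc : `|f (c i) - f s| <= eta.
  rewrite (symmetric_shift zV) in zs.
  by have := feta _ zs s; rewrite mulVKg.
rewrite -(subrKA (y ** a)) -amulNl -amulDl -dynsysB.
rewrite (le_trans (ler_normD _ _))// mulrDl mul1r lerD//.
rewrite (le_trans (norm_amul _ _))// mulrAC ler_pM//.
by rewrite (le_trans (alphaM _ _))// ler_wpM2l.
Qed.

(** Both sides are compared with the image [iota Sf] of one Riemann sum: in [L] it
    approximates the weak integral, and pointwise on the compact set [K1] it
    approximates the untwisted [f]. *)
Lemma integrated_approx (f : Cc G A) (V : set G) (M : R) (S : set A) (e : R) :
  nbhs (1%g : G) V -> has_bounded_approx_right_id M S -> 0 < e ->
  exists (z : Cc G R^o) (a : A),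
    [/\ S a /\ `|a| <= M, forall s, 0 <= z s, forall s, ~ V s -> z s = 0,
       (\int[mu]_s (z s)%:E = 1)%E &
       `|integrated mu rho f (iota (Cc_tensor z a)) - iota (untwist alphaM f)| < e].
Proof.
move=> V1 hS e0.
have [K0 cK0 fK0] := Cc_support f.
have [Kn Kn1 cKn] := compact_nbhs (1%g : G).
have Kne : Kn 1%g := nbhs_singleton Kn1.
pose K1 := [set (s * t)%g | s in K0 & t in Kn].
pose K2 := [set (s * t)%g | s in K1 & t in Kn].
have cK1 : compact K1 by exact: compact_mulg.
have cK2 : compact K2 by exact: compact_mulg.
have K01 : K0 `<=` K1 by move=> s Ks; exists s => //; exists 1%g => //; rewrite mulg1.
have K12 : K1 `<=` K2 by move=> s Ks; exists s => //; exists 1%g => //; rewrite mulg1.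
have [C C0 CP] := iota_norm_compact weight_w iota_norm cK1.
have [Y Y0 YP] := Cc_bounded (untwist alphaM f).
have M0 : 0 <= M.
  have [a [_ aM _]] := approx_right_id_uniform (untwist alphaM f) hS ltr01.
  exact: le_trans aM.
have MM0 : 0 <= Ma * M by exact: mulr_ge0.
(* [eta] controls the errors made by the approximate identity of A and by the
   modulus of continuity of f, [d] those made by the Riemann sums. *)
pose D := 8 * (C + 1) * (Ma * M + 1).
have D0 : 0 < D by rewrite !mulr_gt0// ltr_wpDl.
pose eta := e / D.
have eta0 : 0 < eta by exact: divr_gt0.
have etaE : eta * D = e by rewrite divfK// gt_eqF.
clearbody eta.
have [a [Sa aM aP]] := approx_right_id_uniform (untwist alphaM f) hS eta0.
pose N := (V `&` Kn) `&` [set v | forall s, `|f (s * v)%g - f s| < eta].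
have N1 : nbhs (1%g : G) N.
  by apply: filterI; [exact: filterI|exact: Cc_uniformly_continuous].
have [z [z0 zV zN zI]] := normalized_bump haar_mu N1.
have Nz v : z v != 0 -> N v.
  by move=> zv; apply: contrapT => /zN zv0; rewrite zv0 eqxx in zv.
exists z, a; split => //.
  by move=> s nVs; apply: zN => -[[]].
set x := iota (Cc_tensor z a).
pose mK := fine (mu K2).
have mK0 : 0 <= mK by exact: fine_ge0.
pose t0 := Num.min 1 (e / 4 / (1 + C * Y)).
have CY0 : 0 <= C * Y by exact: mulr_ge0.
have t00 : 0 < t0 by rewrite lt_min ltr01 !divr_gt0// ltr_wpDr.
have t01 : t0 <= 1 by rewrite ge_min lexx.
have t0e : t0 * (1 + C * Y) <= e / 4.
  by rewrite -ler_pdivlMr ?ltr_wpDr// ge_min lexx orbT.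
pose d := t0 / (mK + 1).
have d0 : 0 < d by rewrite divr_gt0// ltr_wpDl.
have dE : d * (mK + 1) = t0 by rewrite divfK// gt_eqF// ltr_wpDl.
clearbody d.
pose F r := crpi rho (f r) (crU rho r x).
have cF : continuous F := @integrand_continuous _ _ _ _ _ _ Ma0 alphaM _ weight_w
  _ _ beurling_L _ regular_rho f x.
have [|n [c [B [mB tB BK cK BN]]]] := @compact_partition G K2
    (fun r0 => [set r | `|F r - F r0| <= d] `&`
       [set r | forall s, `|z (r^-1 * s)%g - z (r0^-1 * s)%g| <= d]) cK2.
  move=> r0 _; apply: filterI.
    near=> r; rewrite /= distrC; near: r.
    by have /cvgrPdist_le := cF r0; apply.
  have zu := Cc_uniformly_continuous z d0.
  have := @nbhs_left_mulg G r0^-1%g r0 [set v | forall s, `|z (s * v)%g - z s| < d].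
  rewrite mulVg => /(_ zu); apply: filterS => r /= zr s.
  rewrite !(symmetric_shift zV _ s) ltW//.
  by have := zr (s^-1 * r0)%g; rewrite -mulgA mulVKg.
have [fB _] := partition_mass haar_mu cK2 mB tB BK.
pose m i := fine (mu (B i)).
have m0 i : 0 <= m i by exact: fine_ge0.
pose Sf := \sum_(i < n) m i *: left_pi alpha (f (c i)) (left_shift (c i) (Cc_tensor z a)).
have SfE : iota Sf = riemann_sum mu c B F.
  rewrite /Sf linear_sum; apply: eq_bigr => i _.
  by rewrite linearZ /= /F /x (lr_U regular_rho) (lr_pi regular_rho).
have le1 : `|integrated mu rho f x - iota Sf| <= d * mK.
  rewrite SfE; apply: (is_vint_riemann haar_mu cK2 mB tB BK).
  - exact: (integrated_is_vint haar_mu Ma0 alphaM weight_w beurling_L regular_rho).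
  - move=> s nKs; rewrite /F fK0 ?linear0//; last by move=> Ks; apply/nKs/K12/K01.
  - by move=> i r /BN[].
have SfsE s : Sf s = \sum_(i < n)
    m i *: (alpha s^-1%g (f (c i)) ** (z ((c i)^-1 * s)%g *: a)).
  by rewrite /Sf Cc_sumE; apply: eq_bigr => i _; rewrite Cc_scaleE.
have le2 : `|iota (Sf - untwist alphaM f)| <= C * (2 * ((Ma * M + 1) * eta) + d * mK * Y).
  have off s : ~ K1 s -> (Sf - untwist alphaM f) s = 0.
    move=> nKs; rewrite Cc_subE /= (fK0 s); last by move=> /K01.
    rewrite dynsys0 subr0 SfsE big1// => i _.
    have [zs0|zs] := eqVneq (z ((c i)^-1 * s)%g) 0.
      by rewrite zs0 scale0r amula0 scaler0.
    rewrite (fK0 (c i)); last first.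
      move=> K0c; apply: nKs; exists (c i) => //; exists ((c i)^-1 * s)%g.
        by have [[]] := Nz _ zs.
      by rewrite mulVKg.
    by rewrite dynsys0 amul0l scaler0.
  apply: CP => // s; have [Ks|/off ->] := pselect (K1 s); last first.
    by rewrite normr0 addr_ge0 ?mulr_ge0 ?addr_ge0 ?(ltW eta0) ?(ltW d0).
  pose Z := \sum_(i < n) m i * z ((c i)^-1 * s)%g.
  have Z1 : `|1 - Z| <= d * mK.
    pose g r := z (r^-1 * s)%g.
    have gE : g = (fun r => z (s^-1 * r)%g).
      by apply/funext => r; exact: symmetric_shift.
    have cg : continuous (g : G -> R).
      rewrite gE => r; apply: (@continuous_comp _ _ _ (fun r : G => (s^-1 * r)%g) (z : G -> R)).
        exact: left_mulg_continuous.
      exact: (@Cc_continuous R G R^o z).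
    apply: (riemann_sum_scalar haar_mu cK2 mB tB BK (g := g)).
    - exact: continuous_borel_fun.
    - move=> r nKr; apply/eqP; apply: contrapT => /negP; rewrite gE/= => /Nz[[_ Knr] _].
      by apply: nKr; exists s => //; exists (s^-1 * r)%g => //; rewrite mulVKg.
    - by move=> i r /BN[_]; exact.
    - rewrite gE -zI -(haar_integral_left_mulg haar_mu s^-1%g)//.
      apply/measurable_EFinP; apply: continuous_borel_fun.
      exact: (@Cc_continuous R G R^o z).
  have Z2 : Z <= 2.
    by move: Z1 dE d0 t01; rewrite ler_norml => /andP[]; lra.
  have zf v : z v != 0 -> forall t, `|f (t * v)%g - f t| <= eta.
    by move=> /Nz[_ fv] t; exact/ltW/fv.
  rewrite Cc_subE SfsE; apply: (le_trans (untwist_shift_approx z0 zV zf aM (aP s) m0 erefl)).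
  apply: lerD; first by rewrite ler_wpM2r// mulr_ge0 ?addr_ge0// ltW.
  by rewrite distrC ler_pM// YP.
have leI : `|iota Sf - iota (untwist alphaM f)| <= C * (2 * ((Ma * M + 1) * eta) + d * mK * Y).
  by rewrite -linearB.
rewrite -(subrKA (iota Sf)) (le_lt_trans (ler_normD _ _))//.
apply: (le_lt_trans (lerD le1 leI)).
have [q0 qt] : 0 <= d * mK /\ d * mK <= t0.
  by split; [rewrite mulr_ge0// ltW|move: dE d0; lra].
move: (d * mK) q0 qt => q q0 qt.
have qe : q * (1 + C * Y) <= e / 4.
  by apply: le_trans t0e; rewrite ler_wpM2r// addr_ge0.
pose P := (Ma * M + 1) * eta.
have P0 : 0 <= P by rewrite mulr_ge0 ?addr_ge0// ltW.
have PE : 8 * (C * P) + 8 * P = e by rewrite -etaE /D /P; ring.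
have -> : q + C * (2 * P + q * Y) = q * (1 + C * Y) + 2 * (C * P) by ring.
have CP0 : 0 <= C * P by rewrite mulr_ge0.
clearbody P; move: qe PE P0 CP0 e0; lra.
Unshelve. all: by end_near. Qed.

End RegularApproximation.

(** * Extension from a dense subspace *)

Section DenseExtension.
Context {R : realType} (V : lmodType R) (X : normedModType R)
  (Y : completeNormedModType R).
Variables (i : {linear V -> X}) (j : {linear V -> Y}) (M : R).
Hypotheses (di : dense (range i)) (M0 : 0 <= M)
  (jM : forall v, `|j v| <= M * `|i v|).

(** The graph of the extension. *)
Let approximable x y :=
  forall e, 0 < e -> exists v, `|x - i v| <= e /\ `|y - j v| <= M * e.

Let approximable_linear k x y x' y' : approximable x y -> approximable x' y' ->
  approximable (k *: x + x') (k *: y + y').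
Proof.
move=> xy xy' e e0; pose d := e / (`|k| + 1).
have k0 : 0 < `|k| + 1 by rewrite ltr_wpDl.
have d0 : 0 < d by exact: divr_gt0.
have dE : `|k| * d + d = e.
  by rewrite -[X in _ + X]mul1r -mulrDl mulrC divfK// gt_eqF.
have [v [xv yv]] := xy d d0; have [v' [xv' yv']] := xy' d d0.
exists (k *: v + v'); split.
  have -> : k *: x + x' - i (k *: v + v') = k *: (x - i v) + (x' - i v').
    by rewrite linearP opprD addrACA scalerBr.
  by rewrite (le_trans (ler_normD _ _))// normrZ -dE lerD// ler_wpM2l.
have -> : k *: y + y' - j (k *: v + v') = k *: (y - j v) + (y' - j v').
  by rewrite linearP opprD addrACA scalerBr.
rewrite (le_trans (ler_normD _ _))// normrZ -dE mulrDr lerD//.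
by rewrite mulrCA ler_wpM2l.
Qed.

Let approximable_bound x y : approximable x y -> `|y| <= M * `|x|.
Proof.
move=> xy; apply/ler_addgt0Pr => e e0; pose d := e / (2 * M + 1).
have M1 : 0 < 2 * M + 1 by rewrite ltr_wpDl// mulr_ge0.
have d0 : 0 < d by exact: divr_gt0.
have dE : d * (2 * M + 1) = e by rewrite divfK// gt_eqF.
have [v [xv yv]] := xy d d0.
have y1 : `|y| <= `|y - j v| + `|j v|.
  by rewrite -{1}(subrK (j v) y) ler_normD.
have v1 : M * `|i v| <= M * (`|x - i v| + `|x|).
  apply: ler_wpM2l => //; rewrite distrC -{1}(subrK x (i v)).
  exact: ler_normD.
have v2 : M * (`|x - i v| + `|x|) <= M * (d + `|x|) by rewrite ler_wpM2l// lerD2r.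
by have := jM v; clearbody d; lra.
Qed.

Let approximable_exists x : exists y, approximable x y.
Proof.
have [v vP] : exists v : nat -> V, forall n, `|x - i (v n)| < n.+1%:R^-1.
  suff /choice[v vP] : forall n, exists v, `|x - i v| < n.+1%:R^-1 by exists v.
  move=> n; have [|_ [v _ <-] xv] := dense_approx di x (e := n.+1%:R^-1).
    by rewrite invr_gt0.
  by exists v.
have [m n|y yP] := @harmonic_cauchy _ Y (j \o v) M.
  rewrite /= -linearB (le_trans (jM _))// -mulrDr ler_wpM2l// linearB /=.
  rewrite -(subrKA x) (le_trans (ler_normD _ _))// lerD//.
    by rewrite distrC ltW.
  exact: ltW.
exists y => e e0; have [n] := harmonic_lt 1 e0; rewrite div1r => /ltW ne.
exists (v n); split; first by rewrite (le_trans (ltW (vP n))).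
by rewrite (le_trans (yP n))// ler_wpM2l.
Qed.

Lemma dense_extension :
  exists2 T : {linear X -> Y}, forall v, T (i v) = j v &
    forall x, `|T x| <= M * `|x|.
Proof.
have [T TP] := choice approximable_exists.
have uniq x y : approximable x y -> T x = y.
  move=> xy; have := approximable_bound (approximable_linear (-1) xy (TP x)).
  rewrite !scaleN1r addNr normr0 mulr0 normr_le0 addrC subr_eq0.
  by move=> /eqP.
have Tlin : linear T by move=> k x x'; apply: uniq; exact: approximable_linear.
pose TL : {linear X -> Y} := HB.pack T (GRing.isLinear.Build R X Y *:%R T Tlin).
exists TL; last by move=> x; exact: approximable_bound (TP x).
move=> v; apply: uniq => e e0; exists v.
by rewrite !subrr !normr0; split; rewrite ?mulr_ge0// ltW.
Qed.

End DenseExtension.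

Lemma dense_eq {R : realType} (X Y : normedModType R) (S : set X) (f g : X -> Y) :
  dense S -> continuous f -> continuous g -> (forall x, S x -> f x = g x) ->
  f =1 g.
Proof.
move=> dS cf cg fg x; apply/eqP; rewrite -subr_eq0 -normr_le0.
rewrite -(mul0r `|x|).
apply: (@dense_norm_le _ _ _ _ (fun x => f x - g x) 0 dS).
  by move=> y; apply: cvgB; [exact: cf|exact: cg].
by move=> y /fg ->; rewrite subrr normr0 mul0r.
Qed.

Lemma closure_image_le {R : realType} (I : Type) (X Y : normedModType R)
    (i : I -> X) (j : I -> Y) (T : {linear X -> Y}) (S : set I) (M : R) x :
  (forall v, T (i v) = j v) -> (forall x, `|T x| <= M * `|x|) ->
  closure (i @` S) x -> closure (j @` S) (T x).
Proof.
move=> Tij TM /closure_approx Sx; apply/closure_approx => e e0.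
have M1 : 0 < `|M| + 1 by rewrite ltr_wpDl.
have [_ [v Sv <-] xv] := Sx (e / (`|M| + 1)) (divr_gt0 e0 M1).
exists (j v); first by exists v.
rewrite -Tij -linearB (le_lt_trans (TM _))//.
move: xv; rewrite ltr_pdivlMr// => /(le_lt_trans _); apply.
rewrite mulrC ler_wpM2l//; have := ler_norm M; lra.
Qed.

Lemma isometric_topological_embedding {R : realType} (X Y : normedModType R)
    (T : {linear X -> Y}) : isometric T -> topological_embedding T.
Proof.
move=> Ti; split.
- move=> x y xy; apply/eqP; rewrite -subr_eq0 -normr_eq0 -Ti linearB /= xy.
  by rewrite subrr normr0.
- by apply: (@linear_bound_continuous _ _ _ T 1) => x; rewrite mul1r Ti.
move=> U oU; exists (\bigcup_(p in [set p : X * R | ball p.1 p.2 `<=` U]) ball (T p.1) p.2).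
  by apply: bigcup_open => p _; exact: ball_open.
apply/seteqP; split => [_ [x Ux <-]|y [[[x r] /= xU xy] [z _ zy]]].
  split; last by exists x.
  have /nbhs_ballP[r /= r0 xr] : nbhs x U by apply: open_nbhs_nbhs; split.
  by exists (x, r) => //=; exact: ballxx.
exists z => //; apply: xU; move: xy; rewrite -zy -!ball_normE /=.
by rewrite -linearB Ti.
Qed.

(** * The crossed product of the left regular representation *)

Section CrossedProduct.
Context {R : realType} {A : preBanachAlgType R} {G : lcgroupType}.
Variable mu : {measure set (borel G) -> \bar R}.
Hypothesis haar_mu : left_haar_measure mu.
Variables (alpha : dynsys A G) (Ma : R).
Hypothesis Ma0 : 0 <= Ma.
Hypothesis alphaM : forall s a, `|alpha s a| <= Ma * `|a|.
Variable w : G -> R.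
Hypothesis weight_w : weight w.
Variables (L : preCompleteAlgType R) (iota : {linear Cc G A -> L}).
Hypothesis beurling_L : beurling_algebra alpha mu w iota.
Variable rho : covrep alpha L.
Hypothesis regular_rho : left_regular_rep iota rho.

Let iota_norm := ba_norm beurling_L.
Local Notation I := (integrated mu rho).

Let I_linear f : linear (I f).
Proof.
exact: (integrated_linear haar_mu Ma0 alphaM weight_w beurling_L regular_rho).
Qed.

Let I_le f x : `|I f x| <= Ma * `|iota f| * `|x|.
Proof.
exact: (integrated_le haar_mu Ma0 alphaM weight_w beurling_L regular_rho).
Qed.

Lemma integrated_bop_subproof f : I f \in @bop_pred R L.
Proof.
apply/asboolP; split; first exact: I_linear.
pose T : {linear L -> L} := HB.pack (I f) (GRing.isLinear.Build R L L *:%R (I f) (I_linear f)).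
exact: (@linear_bound_continuous _ _ _ T (Ma * `|iota f|) (I_le f)).
Qed.

Definition integrated_bop f : bop L := Bop (integrated_bop_subproof f).

Lemma opnorm_integrated_le f : opnorm (I f) <= Ma * `|iota f|.
Proof.
apply: (@opnorm_le _ _ (integrated_bop f)) => x x1.
by rewrite (le_trans (I_le f x))// ler_piMr// mulr_ge0.
Qed.

(** Stated for bumps rather than for [w], so as to cover the zero algebra, where
    [weight_le_shift] gives no bound on the weight. *)
Definition bump_bounded (V : set G) (B : R) :=
  forall (z : Cc G R^o) (a : A), (forall s, 0 <= z s) ->
    (forall s, ~ V s -> z s = 0) -> (\int[mu]_s (z s)%:E = 1)%E ->
    `|iota (Cc_tensor z a)| <= `|a| * B.

(** By [weight_le_shift] and the strong continuity of the translations, [w] is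
    bounded near the unit. *)
Lemma bump_bounded_nbhs1 :
  exists V B, [/\ nbhs (1%g : G) V, 0 <= B & bump_bounded V B].
Proof.
have [[a a0]|/forallNP A0] := pselect (exists a : A, a != 0); last first.
  exists setT, 0; split => //; first exact: filterT.
  move=> z a _ _ _; rewrite mulr0 (_ : Cc_tensor z a = 0) ?linear0 ?normr0//.
  by apply: Cc_ext => s; have /negP/negPn/eqP := A0 (Cc_tensor z a s).
have [h [M wM]] := weight_le_shift haar_mu weight_w iota_norm
  (shift := @left_shift R A G) a0 (fun _ _ _ => erefl).
pose x := iota h.
pose V := [set r | `|crU rho r x| < `|x| + 1].
exists V, (`|M| * (`|x| + 1)).
have B0 : 0 <= `|M| * (`|x| + 1) by rewrite mulr_ge0// addr_ge0.
split => //.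
  have /cvgrPdist_lt/(_ 1 ltr01) := @crU_continuous _ _ _ _ _ rho x 1%g.
  apply: filterS => r /=; rewrite crU1 distrC => rx.
  rewrite /V /= -{1}(subrK x (crU rho r x)).
  by rewrite (le_lt_trans (ler_normD _ _))// addrC ltrD2l.
move=> z a' z0 zV zI; apply: (tensor_norm_le weight_w beurling_L a' z0 zV zI B0).
move=> r /= rx; apply: (le_trans (wM r)).
rewrite -(lr_U regular_rho) -/x (@le_trans _ _ (`|M| * `|crU rho r x|))//.
  by rewrite ler_wpM2r// ler_norm.
by rewrite ler_wpM2l// ltW.
Qed.

(** Testing [I f] on an approximate identity recovers the norm of [f], up to
    the constants of the twist and of the approximate identity. *)
Lemma iota_norm_le_opnorm (V : set G) (B M : R) (S : set A) :
  nbhs (1%g : G) V -> 0 <= B -> bump_bounded V B ->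
  has_bounded_approx_right_id M S ->
  forall f, `|iota f| <= Ma * (M * B * opnorm (I f)).
Proof.
move=> V1 B0 VB hS f.
have op0 : 0 <= opnorm (I f) := normr_ge0 (integrated_bop f).
have : `|iota (untwist alphaM f)| <= M * B * opnorm (I f).
  apply/ler_addgt0Pr => e e0.
  have [z [a [[Sa aM] z0 zV zI za]]] := integrated_approx haar_mu Ma0 alphaM
    weight_w beurling_L regular_rho f V1 hS e0.
  set x := iota (Cc_tensor z a) in za.
  have x1 : `|x| <= M * B by rewrite (le_trans (VB z a z0 zV zI))// ler_wpM2r.
  have x2 : `|I f x| <= opnorm (I f) * `|x| := opnormP (integrated_bop f) x.
  rewrite -(subrK (I f x) (iota (untwist alphaM f))) (le_trans (ler_normD _ _))//.
  rewrite addrC lerD//; last by rewrite distrC ltW.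
  by rewrite (le_trans x2)// mulrC ler_wpM2r.
move=> /(ler_wpM2l Ma0); apply: le_trans; rewrite -{1}(untwistK alphaM f).
by apply: (iota_norm_le weight_w iota_norm) => // s; exact: alphaM.
Qed.

(** The extension is made at each vector [x] of [L] separately, with values in the
    complete space [L]. It is isometric because [q] carries the operator norm. *)
Lemma integrated_extension (C : completeNormedModType R)
    (q : {linear Cc G A -> C}) :
  dense (range q) -> (forall f, `|q f| = opnorm (I f)) ->
  exists2 Psi : {linear C -> bop L}, isometric Psi &
    forall f, Psi (q f) = integrated_bop f.
Proof.
move=> dq qI.
have ext x : exists E : {linear C -> L},
    (forall f, E (q f) = I f x) /\ forall c, `|E c| <= `|x| * `|c|.
  have jl : linear (fun f => I f x).
    move=> k f g.
    exact: (integrated_linearl haar_mu Ma0 alphaM weight_w beurling_L regular_rho).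
  pose j : {linear Cc G A -> L} :=
    HB.pack (fun f => I f x) (GRing.isLinear.Build R (Cc G A) L *:%R _ jl).
  have [f|E Ej EM] := @dense_extension _ _ _ _ q j `|x| dq (normr_ge0 x).
    by rewrite qI mulrC; exact: (opnormP (integrated_bop f) x).
  by exists E.
have [E EP] := choice ext.
have Ec x : continuous (E x) := linear_bound_continuous (EP x).2.
have El c : linear (fun x => E x c).
  move=> k x y; move: c; apply: (dense_eq dq) => [||_ [f _ <-]].
  - exact: Ec.
  - move=> c; apply: cvgD; last exact: Ec.
    by apply: cvgZl_tmp; exact: Ec.
  - by rewrite !(EP _).1 I_linear.
have Eb c : (fun x => E x c) \in @bop_pred R L.
  apply/asboolP; split => //.
  pose T : {linear L -> L} := HB.pack (fun x => E x c) (GRing.isLinear.Build R L L *:%R _ (El c)).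
  apply: (@linear_bound_continuous _ _ _ T `|c|) => x.
  by rewrite mulrC; exact: (EP x).2.
pose psi c : bop L := Bop (Eb c).
have psil : linear psi.
  by move=> k c d; apply: bop_eq => x; rewrite bop_addE bop_scaleE /= linearP.
pose Psi : {linear C -> bop L} := HB.pack psi (GRing.isLinear.Build R C (bop L) *:%R psi psil).
have Psiq f : Psi (q f) = integrated_bop f.
  by apply: bop_eq => x; exact: (EP x).1.
have Psi1 c : `|Psi c| <= 1 * `|c|.
  rewrite mul1r; apply: opnorm_le => x x1.
  by rewrite (le_trans ((EP x).2 c))// ler_piMl.
exists Psi => // c; apply/eqP; rewrite eq_le -{1}[`|c|]mul1r Psi1 /=.
move: c; apply: (dense_le dq).
- by move=> c; apply: cvg_norm; exact: cvg_id.
- by move=> c; apply: cvg_norm; exact: (linear_bound_continuous Psi1).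
- by move=> _ [f _ <-]; rewrite qI -[X in _ <= `|X|]/(Psi (q f)) Psiq.
Qed.

(** Let [c] be close to [q f]. The value of [Psi c] at a positive approximate
    identity [g] is positive and close to [I f g], hence to the untwisted [f]; so
    the twist of a positive function close to that value is close to [f]. *)
Lemma integrated_extension_reflects_pos (C : completeNormedModType R)
    (q : {linear Cc G A -> C}) (Psi : {linear C -> bop L}) (M : R) (c : C) :
  dense (range q) -> (forall f, `|q f| = opnorm (I f)) ->
  isometric Psi -> (forall f, Psi (q f) = integrated_bop f) ->
  has_bounded_approx_right_id M (vpos : set A) ->
  vpos (Psi c : bop L) -> closure (q @` Cc_pos G A) c.
Proof.
move=> dq qI Psi1 Psiq hM Psic; apply/closure_approx => e e0.
have [V [B [V1 B0 VB]]] := bump_bounded_nbhs1.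
have M0 : 0 <= M.
  by have [a [_ aM _]] := approx_right_id_uniform (0 : Cc G A) hM ltr01; exact: le_trans aM.
have H0 : 0 <= M * B by exact: mulr_ge0.
pose D := 1 + Ma * (Ma * (M * B + 2)).
have D0 : 0 < D by rewrite ltr_wpDr// !mulr_ge0// addr_ge0.
pose d := e / D.
have d0 : 0 < d by exact: divr_gt0.
have dE : d * D = e by rewrite divfK// gt_eqF.
clearbody d.
have [_ [f _ <-] cf] := dense_approx dq c d0.
have [z [a [[Sa aM] z0 zV zI za]]] := integrated_approx haar_mu Ma0 alphaM
  weight_w beurling_L regular_rho f V1 hM d0.
set g := iota (Cc_tensor z a) in za.
have g1 : `|g| <= M * B by rewrite (le_trans (VB z a z0 zV zI))// ler_wpM2r.
have g0 : vpos g.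
  rewrite (ba_pos beurling_L); apply: subset_closure; exists (Cc_tensor z a) => //.
  by move=> s; apply: vposZ.
have : vpos (Psi c g) by apply: Psic; exists g.
rewrite (ba_pos beurling_L) => /closure_approx/(_ d d0)[_ [p p0 <-] gp].
exists (q (twist alphaM p)).
  by exists (twist alphaM p) => //; exact: twist_pos.
have le1 : `|Psi c g - I f g| <= d * (M * B).
  have -> : Psi c g - I f g = (Psi (c - q f) : bop L) g.
    by rewrite linearB bop_subE Psiq.
  rewrite (le_trans (opnormP _ _))// ler_pM//; last first.
    by rewrite -[opnorm _]/(`|Psi (c - q f)|) Psi1 ltW.
  exact: normr_ge0 (Psi (c - q f)).
have le2 : `|iota (p - untwist alphaM f)| <= d * (M * B + 2).
  rewrite linearB /= -(subrKA (Psi c g)) (le_trans (ler_normD _ _))//.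
  have -> : d * (M * B + 2) = d + (d * (M * B) + d) by ring.
  rewrite lerD//; first by rewrite distrC ltW.
  rewrite -(subrKA (I f g)) (le_trans (ler_normD _ _))// lerD//.
  exact: ltW.
have le3 : `|iota (f - twist alphaM p)| <= Ma * (d * (M * B + 2)).
  rewrite -{1}(untwistK alphaM f) -twistB.
  apply: (@le_trans _ _ (Ma * `|iota (untwist alphaM f - p)|)).
    by apply: (iota_norm_le weight_w iota_norm) => // s; exact: alphaM.
  by rewrite ler_wpM2l// linearB distrC -linearB.
rewrite -(subrKA (q f)) (le_lt_trans (ler_normD _ _))// -dE /D mulrDr mulr1.
rewrite ltr_leD// -linearB qI (le_trans (opnorm_integrated_le _))//.
have -> : d * (Ma * (Ma * (M * B + 2))) = Ma * (Ma * (d * (M * B + 2))) by ring.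
exact: ler_wpM2l.
Qed.

End CrossedProduct.

Lemma sigma_singleton {R : realType} {A : preBanachAlgType R} {G : lcgroupType}
    (mu : {measure set (borel G) -> \bar R}) (alpha : dynsys A G)
    (X : completeNormedModType R) (rho : covrep alpha X) (f : Cc G A) :
  sigma mu (singleton_class rho) f = opnorm (integrated mu rho f).
Proof.
rewrite /sigma (_ : [set _ | _] = [set opnorm (integrated mu rho f)]) ?sup1//.
apply/seteqP; split => [_ [_ -> ->]//|_ ->].
by exists (existT (fun Y : completeNormedModType R => covrep alpha Y) X rho).
Qed.

Lemma amul_morph_dense {R : realType} (V : lmodType R) (L : preCompleteAlgType R)
    (C : preBanachAlgType R) (mulV : V -> V -> V) (i : {linear V -> L})
    (j : {linear V -> C}) (Phi : {linear L -> C}) :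
  dense (range i) -> continuous (fun p : L * L => p.1 ** p.2) ->
  continuous Phi -> (forall v, Phi (i v) = j v) ->
  (forall u v, i (mulV u v) = i u ** i v) ->
  (forall u v, j (mulV u v) = j u ** j v) -> {morph Phi : x y / x ** y}.
Proof.
move=> di cm cP Pi im jm.
have cml y : continuous (fun x : L => x ** y).
  move=> x; apply: (@continuous_comp _ _ _ (fun x : L => (x, y))
    (fun p : L * L => p.1 ** p.2)); last exact: cm.
  by apply: cvg_pair => /=; [exact: cvg_id|exact: cvg_cst].
have cmr x : continuous (fun y : L => x ** y).
  move=> y; apply: (@continuous_comp _ _ _ (fun y : L => (x, y))
    (fun p : L * L => p.1 ** p.2)); last exact: cm.
  by apply: cvg_pair => /=; [exact: cvg_cst|exact: cvg_id].
move=> x y; move: x; apply: (dense_eq di) => [x|x|_ [u _ <-]].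
- by apply: (@continuous_comp _ _ _ (fun x : L => x ** y) Phi); [exact: cml|exact: cP].
- by apply: amul_cvg; [exact: cP|exact: cvg_cst].
move: y; apply: (dense_eq di) => [y|y|_ [v _ <-]].
- by apply: (@continuous_comp _ _ _ (fun y : L => i u ** y) Phi); [exact: cmr|exact: cP].
- by apply: amul_cvg; [exact: cvg_cst|exact: cP].
- by rewrite -im !Pi jm.
Qed.

Theorem theorem5p7 (R : realType) (A : preBanachAlgType R) (G : lcgroupType)
    (mu : {measure set (borel G) -> \bar R}) (haar_mu : left_haar_measure mu)
    (alpha : dynsys A G) (alpha_bounded : uniformly_bounded alpha)
    (A_approx : exists M : R,
      has_bounded_approx_right_id M ([set: A] : set A))
    (w : G -> R) (weight_w : weight w)
    (L : preCompleteAlgType R) (iota : {linear Cc G A -> L})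
    (beurling_L : beurling_algebra alpha mu w iota)
    (rho : covrep alpha L) (regular_rho : left_regular_rep iota rho)
    (C : preBanachAlgType R) (q : {linear Cc G A -> C})
    (crossed_C : crossed_product mu (singleton_class (X := L) rho) q) :
  exists (Phi : {linear L -> C}) (Psi : {linear C -> bop L}),
    [/\ [/\ topological_isomorphism Phi, bipositive_map Phi &
           forall f, Phi (iota f) = q f],
        [/\ topological_embedding Psi, positive_map Psi,
           forall f x, Psi (q f) x = integrated mu rho f x &
           (exists M : R, has_bounded_approx_right_id M (vpos : set A)) ->
             bipositive_map Psi] &
        forall (Z : set (set G)) (K : set G),
          has_bounded_approx_right_id 1 ([set: A] : set A) ->
          (forall s, isometric (alpha s)) ->
          neighbourhood_base1 Z ->
          compact K -> (forall W, Z W -> W `<=` K) ->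
          ereal_inf [set ereal_sup [set (w r)%:E | r in W] | W in Z] = 1%:E ->
          isometric Phi /\ isometric Psi].
Proof.
have [Ma Ma0 alphaM] : exists2 Ma, 0 <= Ma & forall s a, `|alpha s a| <= Ma * `|a|.
  have [M MP] := alpha_bounded; exists `|M| => // s a.
  by rewrite (le_trans (MP s a))// ler_wpM2r// ler_norm.
have qI f : `|q f| = opnorm (integrated mu rho f).
  by rewrite (cp_norm crossed_C) sigma_singleton.
have dq := cp_dense crossed_C.
have di := ba_dense beurling_L.
have q_le f : `|q f| <= Ma * `|iota f|.
  rewrite qI.
  exact: (opnorm_integrated_le haar_mu Ma0 alphaM weight_w beurling_L regular_rho).
have [M' M'0 iota_le] : exists2 M', 0 <= M' & forall f, `|iota f| <= M' * `|q f|.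
  have [M hM] := A_approx.
  have M0 : 0 <= M.
    have [a [_ aM _]] := approx_right_id_uniform (0 : Cc G A) hM ltr01.
    exact: le_trans aM.
  have [V [B [V1 B0 VB]]] := bump_bounded_nbhs1 haar_mu weight_w beurling_L regular_rho.
  exists (Ma * (M * B)); first by rewrite !mulr_ge0.
  move=> f; rewrite qI -mulrA.
  exact: (iota_norm_le_opnorm haar_mu Ma0 alphaM weight_w beurling_L
    regular_rho V1 B0 VB hM).
have [Phi Phii PhiM] := dense_extension di Ma0 q_le.
have [Inv Invq InvM] := dense_extension dq M'0 iota_le.
have cPhi : continuous Phi := linear_bound_continuous PhiM.
have cInv : continuous Inv := linear_bound_continuous InvM.
have PhiK : cancel Phi Inv.
  apply: (dense_eq di) => [x|x|_ [f _ <-]]; last by rewrite Phii Invq.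
    by apply: continuous_comp; [exact: cPhi|exact: cInv].
  exact: cvg_id.
have InvK : cancel Inv Phi.
  apply: (dense_eq dq) => [x|x|_ [f _ <-]]; last by rewrite Invq Phii.
    by apply: continuous_comp; [exact: cInv|exact: cPhi].
  exact: cvg_id.
have [Psi Psi1 Psiq] := integrated_extension haar_mu Ma0 alphaM weight_w
  beurling_L regular_rho dq qI.
have Psipos : positive_map Psi.
  move=> _ [c c0 <-] _ [x x0 <-].
  rewrite (ba_pos beurling_L); apply: closed_closure.
  apply/closure_approx => e e0.
  have x1 : 0 < `|x| + 1 by rewrite ltr_wpDl.
  move: c0; rewrite (cp_pos crossed_C) => /closure_approx/(_ _ (divr_gt0 e0 x1)).
  move=> [_ [f f0 <-] cf]; exists (Psi (q f) x).
    rewrite -(ba_pos beurling_L) Psiq.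
    exact: (integrated_pos haar_mu Ma0 alphaM weight_w beurling_L regular_rho).
  rewrite -bop_subE -linearB (le_lt_trans (opnormP _ _))//.
  rewrite -[opnorm _]/(`|Psi (c - q f)|) Psi1.
  apply: (@le_lt_trans _ _ (`|c - q f| * (`|x| + 1))).
    by rewrite ler_wpM2l// lerDl.
  by rewrite -ltr_pdivlMr.
exists Phi, Psi; split.
- split => //.
    split; last by exists Inv; split.
    exact: (amul_morph_dense di (ba_mul_continuous beurling_L) cPhi Phii
      (ba_mul beurling_L) (cp_mul crossed_C)).
  split; first exact: can_inj PhiK.
    move=> _ [x x0 <-]; rewrite (cp_pos crossed_C).
    by apply: (closure_image_le Phii PhiM); rewrite -(ba_pos beurling_L).
  move=> x /=; rewrite (cp_pos crossed_C) -{2}[x]PhiK (ba_pos beurling_L).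
  exact: closure_image_le Invq InvM.
- split => //.
  + exact: isometric_topological_embedding.
  + by move=> f x; rewrite Psiq.
  + move=> [M hM]; split => //; first by have [] := isometric_topological_embedding Psi1.
    move=> c /= c0; rewrite (cp_pos crossed_C).
    exact: (integrated_extension_reflects_pos dq qI Psi1 Psiq hM c0).
- move=> Z K hA1 alpha1 [Z1 Z2] cK ZK wZ; split => // x.
  have alphaM1 s a : `|alpha s a| <= 1 * `|a| by rewrite alpha1 mul1r.
  have q_le1 f : `|q f| <= `|iota f|.
    rewrite qI -[leRHS]mul1r.
    exact: (opnorm_integrated_le haar_mu ler01 alphaM1 weight_w beurling_L regular_rho).
  have q_ge1 f : `|iota f| <= `|q f|.
    apply/ler_addgt0Pr => e e0.
    (* The constants [Ma] and [M] are now 1, and [B] may be taken as [1 + d]. *)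
    have q1 : 0 < `|q f| + 1 by rewrite ltr_wpDl.
    pose d := e / (`|q f| + 1).
    have d0 : 0 < d by exact: divr_gt0.
    have dE : d * (`|q f| + 1) = e by rewrite divfK// gt_eqF.
    have : (ereal_inf [set ereal_sup [set (w r)%:E | r in W] | W in Z] < (1 + d)%:E)%E.
      by rewrite wZ lte_fin ltrDl.
    move=> /ereal_inf_lt[_ [W ZW <-] Wd].
    have wW r : W r -> w r <= 1 + d.
      move=> Wr; rewrite -lee_fin (le_trans _ (ltW Wd))//.
      by apply: ereal_sup_ubound; exists r.
    have B0 : 0 <= 1 + d by rewrite addr_ge0// ltW.
    have VB : bump_bounded mu iota W (1 + d).
      move=> z a z0 zV zI.
      exact: (tensor_norm_le weight_w beurling_L a z0 zV zI B0 wW).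
    have := iota_norm_le_opnorm haar_mu ler01 alphaM1 weight_w beurling_L
      regular_rho (Z1 _ ZW) B0 VB hA1 f.
    rewrite !mul1r -qI => /le_trans; apply.
    by rewrite mulrDl mul1r lerD2l -dE ler_wpM2l ?lerDl// ltW.
  apply/eqP; rewrite eq_le; apply/andP; split.
    apply: (@dense_le _ _ _ (fun x => `|Phi x|) (fun x => `|x|) di) => [y|y|_ [f _ <-]].
    - by apply: cvg_norm; exact: cPhi.
    - by apply: cvg_norm; exact: cvg_id.
    - by rewrite Phii.
  apply: (@dense_le _ _ _ (fun x => `|x|) (fun x => `|Phi x|) di) => [y|y|_ [f _ <-]].
  - by apply: cvg_norm; exact: cvg_id.
  - by apply: cvg_norm; exact: cPhi.
  - by rewrite Phii.
Qed.
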